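(* Let $u_0\in L^\infty(\Omega)$, $u_{\min}:=\inf_{\mathbf{x}\in\Omega}u_0(\mathbf{x})$ and $u_{\max}:=\sup_{\mathbf{x}\in\Omega}u_0(\mathbf{x})$. Assume that $u_{\min}\le U_i^0\le u_{\max}$ for all $i=1,\dots,N$ and that $\|\boldsymbol{\beta}\|_{L^\infty(\Omega\times\mathbb{R}_+)}<\infty$. Let $V^n=(v_{ij}^n)$ be the minimum viscosity matrix $$v_{ij}^n=\max(0,s_{ij}^n,s_{ji}^n)\ \ (j\neq i),\qquad v_{ii}^n=-\sum_{j\ne i}v_{ij}^n .$$ Then the scheme $U^{n+1}=\bigl(I-\Delta t^nM^{-1}(S^n-V^n)\bigr)U^n$ satisfies a local discrete maximum principle with respect to the degrees of freedom: for all $n\ge 0$ and all $i=1,\dots,N$, $$u_{\min}\le\min_{j\in\mathcal{I}(S_i)}U_j^n\le\max_{j\in\mathcal{I}(S_i)}U_j^n\le u_{\max},$$ provided that the time steps $\Delta t^n>0$ are sufficiently small. More precisely, the condition $$\Delta t^n\le\min_{i=1,\dots,N}\frac{m_i}{s_{ii}^n-v_{ii}^n}\qquad\text{for all } n$$ is sufficient (an index $i$ with $s_{ii}^n-v_{ii}^n=0$ imposes no restriction).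
   Context: Mesh and space. $\Omega\subset\mathbb{R}^2$ is an open (bounded) polygonal domain with outward unit normal $\mathbf{n}$, and $\mathcal{K}_h$ is a triangulation of $\Omega$ without hanging nodes. $\mathcal{F}_h^{\mathrm{int}}$ is the set of interior edges, and $\mathbf{x}_1,\dots,\mathbf{x}_N$ are the midpoints of all edges. For each edge $F$ a unit normal $\mathbf{n}_F$ is fixed; for a piecewise polynomial $v$ and $\mathbf{x}\in F\in\mathcal{F}_h^{\mathrm{int}}$ put $v^{\mp}(\mathbf{x})=\lim_{\epsilon\to0^+}v(\mathbf{x}\mp\epsilon\mathbf{n}_F)$ and $[\![v]\!]=v^+-v^-$. The Crouzeix-Raviart space $\mathcal{V}_h$ is the set of functions $v_h$ that are affine on each triangle and satisfy $\int_F[\![v_h]\!]\,\mathrm{d}s=0$ for all $F\in\mathcal{F}_h^{\mathrm{int}}$. Its basis $\varphi_1,\dots,\varphi_N$ is determined by $\varphi_i(\mathbf{x}_j)=\delta_{ij}$. $S_i$ is the support of $\varphi_i$, and for a union of cells $E$, $\mathcal{I}(E)=\{j:|S_j\cap E|\ne0\}$. The mass matrix is $M=\mathrm{diag}(m_1,\dots,m_N)$ with $m_i=\frac13|S_i|$. Velocity. $\boldsymbol{\beta}$ is a velocity field, possibly time-dependent; at time level $n$ it is evaluated at $t=t^n$. It is understood to have traces on the edges, with $\boldsymbol{\beta}\cdot\mathbf{n}_F$ single-valued on each interior edge, so that the integrals below make sense. It is assumed that there is no inflow boundary, i.e. $\{\mathbf{x}\in\partial\Omega:\boldsymbol{\beta}\cdot\mathbf{n}<0\}$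 is empty. Forms (at time $t^n$), where on $\partial K$ the vector $\mathbf{n}$ is the unit normal outward to $K$ and functions on $\partial K$ are traces from inside $K$: $$a_h(u_h,v_h)=\sum_{K\in\mathcal{K}_h}\int_K(\boldsymbol{\beta}\cdot\nabla u_h)\,v_h\,\mathrm{d}\mathbf{x},$$ $$b_h(u_h,v_h)=\sum_{K\in\mathcal{K}_h}\int_{\partial K\setminus\partial\Omega}\boldsymbol{\beta}\cdot\mathbf{n}\,u_hv_h\,\mathrm{d}s-\sum_{F\in\mathcal{F}_h^{\mathrm{int}}}\int_F\mathrm{Up}(u_h,\boldsymbol{\beta})\,(-[\![v_h]\!])\,\mathrm{d}s,$$ $$\mathrm{Up}(u_h,\boldsymbol{\beta})|_F=u_h^-\max(0,\boldsymbol{\beta}\cdot\mathbf{n}_F)+u_h^+\min(0,\boldsymbol{\beta}\cdot\mathbf{n}_F).$$ The $N\times N$ matrix $S^n=(s_{ij}^n)$ is defined by $s_{ij}^n=a_h(\varphi_j,\varphi_i)-b_h(\varphi_j,\varphi_i)$. Here $U^n=(U_1^n,\dots,U_N^n)^T$ and $\Delta t^n=t^{n+1}-t^n$. *)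

(* Defs.v *)
From HB Require Import structures.
From mathcomp Require Import all_boot all_order all_algebra.
From mathcomp Require Import all_classical all_reals all_analysis.
From mathcomp Require Import ess_sup_inf.

Set Implicit Arguments.
Unset Strict Implicit.
Unset Printing Implicit Defensive.

Import Order.TTheory GRing.Theory Num.Theory.
Import numFieldNormedType.Exports.

Local Open Scope classical_set_scope.
Local Open Scope ring_scope.

Section Plane.
Context {R : realType}.
Implicit Types (x y nu : R * R) (D Omega : set (R * R)).

Definition dot x y : R := x.1 * y.1 + x.2 * y.2.

(* The library norm on [R * R] is the max norm; this is the Euclidean one. *)
Definition enorm x : R := Num.sqrt (dot x x).

Definition area : set (R * R) -> \bar R :=
  (@lebesgue_measure R \x @lebesgue_measure R)%E.

Definition frontier D : set (R * R) := closure D `\` interior D.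

Definition segment x y : set (R * R) :=
  [set (1 - s) *: x + s *: y | s in `[0, 1]%classic].

(* The condition [interior (closure Omega) = Omega] says that [Omega] lies on
   one side of its boundary (no slits), so that the outward normal exists. *)
Definition polygonal_domain Omega : Prop :=
  [/\ open Omega, Omega !=set0, connected Omega & bounded_set Omega] /\
  interior (closure Omega) = Omega /\
  exists s : seq ((R * R) * (R * R)),
    frontier Omega = \bigcup_(e in [set` s]) segment e.1 e.2.

Definition grad (v : R * R -> R) x : R * R :=
  ('D_((1, 0) : R * R) v x, 'D_((0, 1) : R * R) v x).

(* One-sided limit at [x] from the side that [nu] points away from: with the
   edge normal [n_F] this is [v^-], with [- n_F] it is [v^+], and with the
   outward normal of [K] it is the trace from inside [K]. *)
Definition trace (W : normedModType R) (v : R * R -> W) nu x : W :=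
  lim (v (x - e *: nu) @[e --> 0^'+]).

Definition has_trace (W : normedModType R) (v : R * R -> W) nu x : Prop :=
  cvg (v (x - e *: nu) @[e --> 0^'+]).

End Plane.

Section EssentialBounds.
Context {R : realType} d {T : measurableType d}.
Variables (mu : {measure set T -> \bar R}) (D : set T) (f : T -> R).

(* Essential bounds over [D]: outside [D] the function is given the value that
   is neutral for the bound. *)
Definition ess_sup_on : \bar R := ess_sup mu (patch (fun=> -oo%E) D (EFin \o f)).
Definition ess_inf_on : \bar R := ess_inf mu (patch (fun=> +oo%E) D (EFin \o f)).

End EssentialBounds.

(* A mesh is given by vertices [p a], cells (sets of three vertex indices) and,
   derived from them, edges (two-element subsets of the cells). *)
Section Mesh.
Context {R : realType} {nv : nat}.
Variables (Omega : set (R * R)) (p : 'I_nv -> R * R).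
Variable cells : {set {set 'I_nv}}.
Implicit Types (A F K : {set 'I_nv}) (g : R * R -> R).

Definition hull A : set (R * R) :=
  [set x | exists w : 'I_nv -> R,
     [/\ forall a, a \in A -> 0 <= w a,
         \sum_(a in A) w a = 1 & x = \sum_(a in A) w a *: p a]].

(* Relative interior of [hull A], i.e. the open triangle or open edge. *)
Definition ohull A : set (R * R) :=
  [set x | exists w : 'I_nv -> R,
     [/\ forall a, a \in A -> 0 < w a,
         \sum_(a in A) w a = 1 & x = \sum_(a in A) w a *: p a]].

Definition nondegenerate K : Prop :=
  forall a b c, a \in K -> b \in K -> c \in K ->
    a != b -> b != c -> a != c ->
    (p b - p a).1 * (p c - p a).2 - (p b - p a).2 * (p c - p a).1 != 0.

(* The last clause excludes hanging nodes: two cells meet exactly in the face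
   spanned by their common vertices (possibly empty). *)
Definition triangulation : Prop :=
  [/\ forall K, K \in cells -> #|K| = 3%N /\ nondegenerate K,
      closure Omega = \bigcup_(K in [set K | K \in cells]) hull K
    & forall K K', K \in cells -> K' \in cells ->
        hull K `&` hull K' = hull (K :&: K')].

Definition edges : {set {set 'I_nv}} :=
  [set F : {set 'I_nv} | (#|F| == 2) && [exists K in cells, F \subset K]].

Definition interior_edges : {set {set 'I_nv}} :=
  [set F in edges | ~~ `[< hull F `<=` frontier Omega >]].

Definition boundary_edges : {set {set 'I_nv}} := edges :\: interior_edges.

Definition cell_edges K : {set {set 'I_nv}} := [set F in edges | F \subset K].

Definition endpoints F : (R * R) * (R * R) :=
  if enum F is [:: a; b] then (p a, p b) else (0, 0).

Definition edge_pt F (s : R) : R * R :=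
  (1 - s) *: (endpoints F).1 + s *: (endpoints F).2.

Definition midpoint F : R * R := 2^-1 *: \sum_(a in F) p a.

Definition edge_length F : R := enorm ((endpoints F).2 - (endpoints F).1).

Definition edge_int F g : R :=
  edge_length F * \int[@lebesgue_measure R]_(s in `]0, 1[) g (edge_pt F s).

Definition edge_integrable F g : Prop :=
  (@lebesgue_measure R).-integrable `]0, 1[
    (fun s => (g (edge_pt F s))%:E).

Definition edge_ae F (P : R * R -> Prop) : Prop :=
  {ae @lebesgue_measure R, forall s, 0 < s < 1 -> P (edge_pt F s)}.

Definition cell_int K g : R :=
  \int[(@lebesgue_measure R \x @lebesgue_measure R)%E]_(x in ohull K) g x.

Definition cell_integrable K g : Prop :=
  (@lebesgue_measure R \x @lebesgue_measure R)%E.-integrable (ohull K)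
    (fun x => (g x)%:E).

Variable nF : {set 'I_nv} -> R * R.

Definition edge_normals : Prop :=
  forall F, F \in edges ->
    dot (nF F) (nF F) = 1 /\
    forall a b, a \in F -> b \in F -> dot (nF F) (p b - p a) = 0.

(* Unit normal on [F] outward to [K]: the one of [nF F], [- nF F] that points
   away from the vertex of [K] opposite to [F]. *)
Definition outward K F : R * R :=
  if [forall a in F, forall c in K :\: F, dot (nF F) (p c - p a) < 0]
  then nF F else - nF F.

Definition vminus (W : normedModType R) (v : R * R -> W) F x : W :=
  trace v (nF F) x.
Definition vplus (W : normedModType R) (v : R * R -> W) F x : W :=
  trace v (- nF F) x.
Definition jump (v : R * R -> R) F x : R := vplus v F x - vminus v F x.

(* Values on the edges and outside [Omega] are irrelevant: only the open cells
   and the one-sided limits on the edges are ever used. *)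
Definition CR_space (v : R * R -> R) : Prop :=
  (forall K, K \in cells ->
     exists (c : R) (g : R * R), forall x, ohull K x -> v x = c + dot g x) /\
  (forall F, F \in interior_edges -> edge_int F (jump v F) = 0).

Definition edge_of (i : 'I_#|edges|) : {set 'I_nv} := enum_val i.

(* The value of [phi i] at the midpoint of an edge is its trace there from any
   adjacent cell. *)
Definition CR_basis (phi : 'I_#|edges| -> R * R -> R) : Prop :=
  forall i, CR_space (phi i) /\
    forall j K, K \in cells -> edge_of j \subset K ->
      trace (phi i) (outward K (edge_of j))
        (midpoint (edge_of j)) = (i == j)%:R.

Section Forms.
Variable b : R * R -> R * R.
Implicit Types u v : R * R -> R.

Definition a_form u v : R :=
  \sum_(K in cells) cell_int K (fun x => dot (b x) (grad u x) * v x).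

(* [b . n_F] is single-valued on interior edges, so either trace will do. *)
Definition flux F x : R := dot (vminus b F x) (nF F).

Definition upwind u F x : R :=
  (vminus u F x : R) * Num.max 0 (flux F x)
  + (vplus u F x : R) * Num.min 0 (flux F x).

(* [\partial K \ \partial Omega] consists of the edges of [K] that do not lie
   on [\partial Omega]. *)
Definition b_form u v : R :=
  \sum_(K in cells) \sum_(F in cell_edges K :&: interior_edges)
    edge_int F (fun x => let n := outward K F in
      dot (trace b n x) n * (trace u n x : R) * (trace v n x : R))
  - \sum_(F in interior_edges)
      edge_int F (fun x => upwind u F x * - jump v F x).

Definition transport_matrix (phi : 'I_#|edges| -> R * R -> R)
    : 'M[R]_#|edges| :=
  \matrix_(i, j) (a_form (phi j) (phi i) - b_form (phi j) (phi i)).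

End Forms.

Section Velocity.
Variable beta : R -> R * R -> R * R.

(* At each time the velocity is integrable on the cells and has integrable
   traces on the edges, with a single-valued normal component inside. *)
Definition velocity_field : Prop :=
  forall t, 0 <= t ->
    (forall K, K \in cells ->
       cell_integrable K (fun x => (beta t x).1) /\
       cell_integrable K (fun x => (beta t x).2)) /\
    (forall K F, K \in cells -> F \in cell_edges K ->
       let n := outward K F in
       [/\ edge_ae F (has_trace (beta t) n),
           edge_integrable F (fun x => (trace (beta t) n x).1)
         & edge_integrable F (fun x => (trace (beta t) n x).2)]) /\
    (forall F, F \in interior_edges ->
       edge_ae F (fun x => dot (vminus (beta t) F x) (nF F)
                           = dot (vplus (beta t) F x) (nF F))).

Definition velocity_bounded : Prop :=
  let Q := [set z : (R * R) * R | Omega z.1 /\ 0 <= z.2] in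
  measurable_fun Q (fun z => beta z.2 z.1) /\
  (ess_sup_on
     ((@lebesgue_measure R \x @lebesgue_measure R) \x @lebesgue_measure R)%E
     Q (fun z => enorm (beta z.2 z.1)) < +oo)%E.

Definition no_inflow : Prop :=
  forall t, 0 <= t -> forall K F, K \in cells -> F \in cell_edges K ->
    F \in boundary_edges ->
    let n := outward K F in
    edge_ae F (fun x => 0 <= dot (trace (beta t) n x) n).

End Velocity.

Section Supports.
Variable phi : 'I_#|edges| -> R * R -> R.

Definition supp i : set (R * R) :=
  closure [set x | (exists2 K, K \in cells & ohull K x) /\ phi i x != 0].

Definition near_dofs (E : set (R * R)) : {set 'I_#|edges|} :=
  [set j | area (supp j `&` E) != 0%E].

Definition lumped_mass i : R := fine (area (supp i)) / 3.

Definition mass_matrix : 'M[R]_#|edges| := diag_mx (\row_i lumped_mass i).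

Definition local_DMP (umin umax : \bar R) (U : nat -> 'cV[R]_#|edges|) : Prop :=
  forall n i,
    let lo := \big[Order.min/+oo%E]_(j in near_dofs (supp i)) (U n j 0)%:E in
    let hi := \big[Order.max/-oo%E]_(j in near_dofs (supp i)) (U n j 0)%:E in
    [/\ (umin <= lo)%E, (lo <= hi)%E & (hi <= umax)%E].

End Supports.
End Mesh.

Section Scheme.
Context {R : realType}.

Definition bounded_data (Omega : set (R * R)) (u0 : R * R -> R) : Prop :=
  measurable_fun Omega u0 /\
  (ess_sup_on (@lebesgue_measure R \x @lebesgue_measure R)%E
     Omega (fun x => `|u0 x|%R) < +oo)%E.

Definition time_levels (t : nat -> R) : Prop :=
  0 <= t 0%N /\ forall n, t n < t n.+1.

Definition time_step (t : nat -> R) n : R := t n.+1 - t n.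

Variable N : nat.

Definition min_viscosity (S : 'M[R]_N) : 'M[R]_N :=
  \matrix_(i, j)
    if i == j then - \sum_(k | k != i) Num.max 0 (Num.max (S i k) (S k i))
    else Num.max 0 (Num.max (S i j) (S j i)).

Definition scheme (M : 'M[R]_N) (S V : R -> 'M[R]_N) (t : nat -> R)
    (U : nat -> 'cV[R]_N) : Prop :=
  forall n, U n.+1 =
    (1%:M - time_step t n *: (invmx M *m (S (t n) - V (t n)))) *m U n.

End Scheme.

(* Main.v *)
Require Import Defs.
From HB Require Import structures.
From mathcomp Require Import all_boot all_order all_algebra.
From mathcomp Require Import all_classical all_reals all_analysis.
From mathcomp Require Import measurable_realfun ring lra.

Set Implicit Arguments.
Unset Strict Implicit.
Unset Printing Implicit Defensive.

Import Order.TTheory GRing.Theory Num.Theory.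
Import numFieldNormedType.Exports.

Local Open Scope classical_set_scope.
Local Open Scope ring_scope.

(** One step of the scheme replaces U_i by
      U_i - dt / m_i * \sum_j L_ij U_j,   L := S - V,
    and the bounds survive because the new value is a convex combination of the
    old ones.  Three facts make it one.
    - The off-diagonal entries of L are nonpositive: this is what the viscosity
      max(0, s_ij, s_ji) is designed for.
    - The rows of L sum to zero.  Those of V do by definition.  Those of S do
      because the basis functions sum to 1 on every open cell (two affine
      functions that agree at the three edge midpoints of a triangle are equal)
      and both forms vanish at the constant 1 in their first argument: a_h
      because its gradient is 0, b_h because on each interior edge the two cell
      fluxes of a test function v add up to the integral of
      (beta . n_F) (v^- - v^+), which is what the upwind flux of 1 contributes
      with the opposite sign ([a_form_sum0], [b_form_sum0]).
    - The masses m_i are positive and finite, since the support of a basis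
      function is bounded and contains a disc ([lumped_mass_gt0]).
    It follows that L_ii >= 0, and the time step restriction says precisely that
    the weight 1 - dt L_ii / m_i of U_i is nonnegative ([step_ge]).  By induction
    all degrees of freedom stay between the bounds of the data; the local minima
    and maxima then do too, being taken over nonempty sets of indices because i
    itself is a neighbour of i.

    The cancellation in b_h needs the geometric fact that an interior edge is
    shared by exactly two cells, lying on opposite sides of it
    ([interior_edge_cells]): the traces from either side are then traces from a
    cell.  An edge that is not contained in the boundary has an inner point
    whose neighbourhood lies in the domain; rays leaving that point on a given
    side are covered by finitely many cells, so one of them reaches the point,
    and the absence of hanging nodes forces it to have the whole edge. *)

(** * Barycentric coordinates *)

Section Barycentric.
Context {R : realType}.
Implicit Types (A B C x n : R * R) (e s k : R).

Definition cross A B C : R :=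
  (B - A).1 * (C - A).2 - (B - A).2 * (C - A).1.

(** Ratio of signed areas: the barycentric coordinate of [x] relative to the
    vertex [C]; the other two are obtained by permuting the vertices
    cyclically. *)
Definition bary A B C x : R := cross A B x / cross A B C.

Lemma dotC A B : dot A B = dot B A.
Proof. by rewrite /dot mulrC [X in _ + X]mulrC. Qed.

Lemma dotNr A B : dot A (- B) = - dot A B.
Proof. by rewrite /dot /=; ring. Qed.

Lemma dotBr A B C : dot A (B - C) = dot A B - dot A C.
Proof. by rewrite /dot /=; ring. Qed.

Lemma dotDr A B C : dot A (B + C) = dot A B + dot A C.
Proof. by rewrite /dot /=; ring. Qed.

Lemma dotZr A k B : dot A (k *: B) = k * dot A B.
Proof. by rewrite /dot /= /GRing.scale /=; ring. Qed.

Lemma dotNl A B : dot (- A) B = - dot A B.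
Proof. by rewrite dotC dotNr dotC. Qed.

Lemma crossC A B C : cross B C A = cross A B C.
Proof. by rewrite /cross /=; ring. Qed.

Lemma bary_combination A B C u v w : cross A B C != 0 -> u + v + w = 1 ->
  bary A B C (u *: A + v *: B + w *: C) = w.
Proof.
move=> d0 /(canRL (addKr _)) ->; rewrite /bary.
apply: (canLR (mulfK d0)); rewrite /cross /= /GRing.scale /=; ring.
Qed.

Lemma bary_sum A B C x : cross A B C != 0 ->
  bary B C A x + bary C A B x + bary A B C x = 1.
Proof.
move=> d0; rewrite /bary [cross C A B]crossC [cross B C A]crossC -!mulrDl.
apply: (canLR (mulfK d0)); rewrite /cross /=; ring.
Qed.

Lemma bary_decomposition A B C x : cross A B C != 0 ->
  x = bary B C A x *: A + bary C A B x *: B + bary A B C x *: C.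
Proof.
move=> d0.
have e : cross A B C *: x = cross A B C *:
    (bary B C A x *: A + bary C A B x *: B + bary A B C x *: C).
  rewrite /bary [cross C A B]crossC [cross B C A]crossC !scalerDr !scalerA.
  rewrite !(mulrC (cross A B C)) !(divfK d0).
  by apply: injective_projections; rewrite /cross /= /GRing.scale /=; ring.
by rewrite -[LHS](scalerK d0) e scalerK.
Qed.

Lemma bary_segment A B C s : cross A B C != 0 ->
  let x := (1 - s) *: A + s *: B in
  [/\ bary B C A x = 1 - s, bary C A B x = s & bary A B C x = 0].
Proof.
move=> d0 x; rewrite {}/x; split.
- have -> : (1 - s) *: A + s *: B = s *: B + 0 *: C + (1 - s) *: A.
    by rewrite scale0r addr0 addrC.
  by rewrite bary_combination 1?crossC // addr0 addrC subrK.
- have -> : (1 - s) *: A + s *: B = 0 *: C + (1 - s) *: A + s *: B.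
    by rewrite scale0r add0r.
  by rewrite bary_combination 1?crossC 1?crossC // add0r subrK.
- have -> : (1 - s) *: A + s *: B = (1 - s) *: A + s *: B + 0 *: C.
    by rewrite scale0r addr0.
  by rewrite bary_combination // addr0 subrK.
Qed.

Lemma bary_line A B C x n e :
  bary A B C (x - e *: n) = bary A B C x + e * - (bary A B C (A + n)).
Proof.
rewrite /bary -mulNr mulrA -mulrDl; congr (_ / _).
by rewrite /cross /= /GRing.scale /=; ring.
Qed.

(** Both sides are affine in [x] and vanish on the line [AB], whose normal is
    [n]: the sign of the coordinate of [C] tells the side of the edge. *)
Lemma bary_normal A B C n : dot n n = 1 -> dot n (B - A) = 0 ->
  cross A B C != 0 -> forall x, bary A B C x * dot n (C - A) = dot n (x - A).
Proof.
move=> n1 nAB d0 x.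
have e y : cross A B y = dot n (y - A) * cross A B (A + n).
  rewrite -[LHS]mulr1 -n1 -[RHS]addr0.
  rewrite -[X in _ = _ + X](mul0r (cross A (A + n) y)) -nAB.
  by rewrite /cross /dot /=; ring.
rewrite /bary e (e C).
have nC0 : dot n (C - A) != 0.
  by apply: contra_neq d0 => h; rewrite e h mul0r.
have n0 : cross A B (A + n) != 0.
  by apply: contra_neq d0 => h; rewrite e h mulr0.
by field; rewrite nC0 n0.
Qed.

Lemma near_right_affine_gt0 s k : 0 < s -> \forall e \near 0^'+, 0 < s + e * k.
Proof.
move=> s0; have k0 : 0 < `|k| + 1 by rewrite ltr_wpDl.
near=> e.
have e0 : 0 < e by near: e; exact: nbhs_right_gt.
have es : e * (`|k| + 1) < s.
  by rewrite -ltr_pdivlMr //; near: e; apply: nbhs_right_lt; exact: divr_gt0.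
have : - (e * k) <= e * `|k|.
  by rewrite -mulrN ler_pM2l // -normrN ler_norm.
by move: es; rewrite mulrDr mulr1; lra.
Unshelve. all: end_near. Qed.

End Barycentric.

(** * Triangles of the mesh *)

Section Cells.
Local Open Scope set_scope.
Context {R : realType} {nv : nat}.
Variable p : 'I_nv -> R * R.
Implicit Types (a b c d : 'I_nv) (A F K : {set 'I_nv}) (x y n : R * R).

Lemma sum_set2 (V : nmodType) (f : 'I_nv -> V) a b : a != b ->
  \sum_(d in [set a; b]) f d = f a + f b.
Proof. by move=> ab; rewrite big_setU1 ?big_set1 // inE. Qed.

Lemma sum_set3 (V : nmodType) (f : 'I_nv -> V) a b c :
  a != b -> b != c -> a != c -> \sum_(d in [set a; b; c]) f d = f a + f b + f c.
Proof.
move=> ab bc ac; rewrite finset.setUC big_setU1 /=; last first.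
  by rewrite !inE negb_or eq_sym ac eq_sym bc.
by rewrite sum_set2 // addrC.
Qed.

(** Affinely independent vertices determine the weights, so that any condition
    on the weights (positivity for the open triangle, nonnegativity for the
    closed one) is a condition on the barycentric coordinates. *)
Lemma triangle_weightsP (P : R -> Prop) a b c x :
  a != b -> b != c -> a != c -> cross (p a) (p b) (p c) != 0 ->
  (exists w : 'I_nv -> R, [/\ forall d, d \in [set a; b; c] -> P (w d),
     \sum_(d in [set a; b; c]) w d = 1
   & x = \sum_(d in [set a; b; c]) w d *: p d]) <->
  [/\ P (bary (p b) (p c) (p a) x), P (bary (p c) (p a) (p b) x)
    & P (bary (p a) (p b) (p c) x)].
Proof.
move=> ab bc ac d0; split.
  move=> [w [Pw]]; rewrite !sum_set3 // => w1 ->.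
  have -> := bary_combination d0 w1.
  have d0a : cross (p b) (p c) (p a) != 0 by rewrite crossC.
  have d0b : cross (p c) (p a) (p b) != 0 by rewrite 2!crossC.
  have -> : bary (p b) (p c) (p a) (w a *: p a + w b *: p b + w c *: p c) = w a.
    by rewrite -addrA [X in bary _ _ _ X]addrC bary_combination // -w1; ring.
  have -> : bary (p c) (p a) (p b) (w a *: p a + w b *: p b + w c *: p c) = w b.
    rewrite addrAC (addrC (w a *: _)) bary_combination // -w1; ring.
  by split; apply: Pw; rewrite !inE eqxx ?orbT.
move=> [Pa Pb Pc].
exists (fun d => if d == a then bary (p b) (p c) (p a) x else
                 if d == b then bary (p c) (p a) (p b) x else
                 bary (p a) (p b) (p c) x).
rewrite !sum_set3 // !eqxx ![_ == a]eq_sym (negbTE ab) (negbTE ac).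
rewrite [c == b]eq_sym (negbTE bc); split.
- by move=> d _; case: ifP => // _; case: ifP.
- exact: bary_sum.
- exact: bary_decomposition.
Qed.

Lemma ohull3P a b c x :
  a != b -> b != c -> a != c -> cross (p a) (p b) (p c) != 0 ->
  ohull p [set a; b; c] x <->
  [/\ 0 < bary (p b) (p c) (p a) x, 0 < bary (p c) (p a) (p b) x
    & 0 < bary (p a) (p b) (p c) x].
Proof. exact: (triangle_weightsP (fun t => 0 < t)). Qed.

Lemma hull3P a b c x :
  a != b -> b != c -> a != c -> cross (p a) (p b) (p c) != 0 ->
  hull p [set a; b; c] x <->
  [/\ 0 <= bary (p b) (p c) (p a) x, 0 <= bary (p c) (p a) (p b) x
    & 0 <= bary (p a) (p b) (p c) x].
Proof. exact: (triangle_weightsP (fun t => 0 <= t)). Qed.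

Lemma ohull_sub_hull A : ohull p A `<=` hull p A.
Proof. by move=> x [w [w0 ? ?]]; exists w; split=> // a /w0/ltW. Qed.

(** Weights on a face extend by zero to the triangle, and weights are unique. *)
Lemma bary_face0 a b c A x :
  a != b -> b != c -> a != c -> cross (p a) (p b) (p c) != 0 ->
  A \subset [set a; b; c] -> c \notin A -> hull p A x ->
  bary (p a) (p b) (p c) x = 0.
Proof.
move=> ab bc ac d0 sA cA [w [_ w1 ->]].
pose w' d := if d \in A then w d else 0.
have sumE (V : nmodType) (f : 'I_nv -> V) : (forall d, d \notin A -> f d = 0) ->
    \sum_(d in A) f d = f a + f b + f c.
  move=> f0; rewrite -sum_set3 // [RHS](big_setID A) /=.
  rewrite (finset.setIidPr sA) [X in _ = _ + X]big1 ?addr0 // => d.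
  by rewrite inE => /andP[/f0].
have <- : w' c = 0 by rewrite /w' (negbTE cA).
have -> : \sum_(d in A) w d *: p d = \sum_(d in A) w' d *: p d.
  by apply: eq_bigr => d dA; rewrite /w' dA.
rewrite sumE => [|d dA]; last by rewrite /w' (negbTE dA) scale0r.
apply: bary_combination => //; rewrite -sumE => [|d dA].
  by rewrite -w1; apply: eq_bigr => d dA; rewrite /w' dA.
by rewrite /w' (negbTE dA).
Qed.

Lemma endpointsP F : #|F| = 2%N ->
  exists a b, [/\ a != b, F = [set a; b] & endpoints p F = (p a, p b)].
Proof.
rewrite cardE /endpoints => sF; have := enum_uniq (mem F).
have := mem_enum (mem F).
case: (enum F) sF => [|a [|b []]] //= _ mF; rewrite inE andbT => ab.
by exists a, b; split => //; apply/finset.setP => d; rewrite -mF !inE.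
Qed.

Lemma hull2P F x : #|F| = 2%N -> hull p F x ->
  exists s, 0 <= s <= 1 /\ x = edge_pt p F s.
Proof.
move=> /endpointsP[a [b [ab FE eE]]]; rewrite /edge_pt eE FE.
move=> [w [w0]]; rewrite !sum_set2 // => w1 ->; exists (w b).
rewrite -w1 addrK /= lerDr !w0 ?inE ?eqxx ?orbT //.
Qed.

Variable cells : {set {set 'I_nv}}.

Lemma card_cell_edge F K : F \in cell_edges cells K -> #|F| = 2%N.
Proof. by rewrite !inE => /andP[/andP[/eqP]]. Qed.

Lemma third_vertex K a b : #|K| = 3%N /\ Defs.nondegenerate p K ->
  a != b -> [set a; b] \subset K ->
  exists c, [/\ K = [set a; b; c], [/\ a != b, b != c & a != c]
    & cross (p a) (p b) (p c) != 0].
Proof.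
move=> [K3 ndK] ab sF.
have /eqP/cards1P[c cE] : #|K :\: [set a; b]| = 1%N.
  by rewrite cardsD (finset.setIidPr sF) cards2 ab K3.
have KE : K = [set a; b; c].
  by rewrite -(finset.setID K [set a; b]) (finset.setIidPr sF) cE.
have /finset.setDP[cK] : c \in K :\: [set a; b] by rewrite cE inE.
rewrite !inE negb_or => /andP[ca cb].
exists c; split=> //; first by split=> //; rewrite eq_sym.
by apply: ndK; rewrite ?KE ?inE ?eqxx ?orbT // eq_sym.
Qed.

(** The first two vertices come in the order that parametrises the edge. *)
Lemma cell_edgeP K F : #|K| = 3%N /\ Defs.nondegenerate p K ->
  F \in cell_edges cells K ->
  exists a b c, [/\ endpoints p F = (p a, p b), F = [set a; b],
    K = [set a; b; c], [/\ a != b, b != c & a != c]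
  & cross (p a) (p b) (p c) != 0].
Proof.
move=> ndK FK; have [a [b [ab FE eE]]] := endpointsP (card_cell_edge FK).
have sFK : [set a; b] \subset K by move: FK; rewrite FE !inE => /andP[].
by have [c [KE dist d0]] := third_vertex ndK ab sFK; exists a, b, c.
Qed.

Lemma cellP K : #|K| = 3%N /\ Defs.nondegenerate p K ->
  exists a b c, [/\ K = [set a; b; c], [/\ a != b, b != c & a != c]
  & cross (p a) (p b) (p c) != 0].
Proof.
move=> ndK; have /card_gt1P[a [b [aK bK ab]]] : (1 < #|K|)%N by case: ndK => ->.
have sK : [set a; b] \subset K.
  by apply/fintype.subsetP => d; rewrite !inE => /orP[]/eqP ->.
by have [c cE] := third_vertex ndK ab sK; exists a, b, c.
Qed.

End Cells.

(** * Outward normals and traces *)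

Section Traces.
Context {R : realType} {nv : nat}.
Variables (p : 'I_nv -> R * R) (cells : {set {set 'I_nv}}).
Variable nF : {set 'I_nv} -> R * R.
Hypothesis triangles : forall K, K \in cells -> #|K| = 3%N /\ Defs.nondegenerate p K.
Hypothesis normals : edge_normals p cells nF.
Local Open Scope set_scope.
Implicit Types (F K : {set 'I_nv}) (x n : R * R) (s e : R).

Lemma outward_cases K F : outward p nF K F = nF F \/ outward p nF K F = - nF F.
Proof. by rewrite /outward; case: ifP; [left|right]. Qed.

(** Nondegeneracy keeps the opposite vertex off the line of the edge, so exactly
    one of the two unit normals points away from it. *)
Lemma outwardP K F : K \in cells -> F \in cell_edges cells K ->
  exists a b c, [/\ endpoints p F = (p a, p b), F = [set a; b],
    K = [set a; b; c], [/\ a != b, b != c & a != c]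
  & cross (p a) (p b) (p c) != 0] /\
  let n := outward p nF K F in
  [/\ dot n n = 1, dot n (p b - p a) = 0 & dot n (p c - p a) < 0].
Proof.
move=> Kc FK; have [a [b [c]]] := cell_edgeP (triangles Kc) FK.
move=> [eE FE KE dist d0]; exists a, b, c; split; first by [].
have [ab bc ac] := dist.
have FK' : F \in edges cells by move: FK; rewrite inE => /andP[].
have [n1 nab] := normals FK'.
have {}nab : dot (nF F) (p b - p a) = 0.
  by apply: nab; rewrite FE !inE eqxx ?orbT.
have nc0 : dot (nF F) (p c - p a) != 0.
  apply: contraTneq isT => h; have := bary_normal n1 nab d0 (p a + nF F).
  by rewrite h mulr0 addrAC subrr add0r n1 => /esym/eqP; rewrite oner_eq0.
have nba d : d \in F -> dot (nF F) (p c - p d) = dot (nF F) (p c - p a).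
  rewrite {1}FE !inE => /orP[]/eqP -> //.
  have -> : p c - p b = (p c - p a) - (p b - p a).
    by rewrite opprB addrA subrK.
  by rewrite dotBr nab subr0.
have cD d : (d \in K :\: F) = (d == c).
  rewrite KE FE !inE negb_or; have [->|da] := eqVneq d a.
    by rewrite (negbTE ac).
  have [->|db] := eqVneq d b; last by [].
  by rewrite (negbTE bc).
rewrite /outward; case: ifPn => [/forall_inP h|h].
  split=> //.
  have /forall_inP : [forall c0 in K :\: F, dot (nF F) (p c0 - p a) < 0].
    by apply: h; rewrite FE !inE eqxx.
  by apply; rewrite cD.
rewrite dotNl dotNr opprK dotNl nab oppr0 dotNl oppr_lt0 lt_def nc0.
split=> //=; rewrite leNgt; apply: contra h => h.
apply/forall_inP => a' a'F; apply/forall_inP => c'; rewrite cD => /eqP ->.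
by rewrite nba.
Qed.

(** Near an inner point of the edge the coordinates of the endpoints stay
    positive, and that of the opposite vertex, zero at the point, increases
    along the inward normal by [bary_normal]. *)
Lemma inward_ray K F s : K \in cells -> F \in cell_edges cells K ->
  0 < s < 1 ->
  \forall e \near 0^'+, ohull p K (edge_pt p F s - e *: outward p nF K F).
Proof.
move=> Kc FK /andP[s0 s1]; have [a [b [c [[eE FE KE dist d0]]]]] := outwardP Kc FK.
have [ab bc ac] := dist.
set n := outward p nF K F => -[n1 nab nc].
set x := edge_pt p F s.
have [xa xb xc] : [/\ bary (p b) (p c) (p a) x = 1 - s,
    bary (p c) (p a) (p b) x = s & bary (p a) (p b) (p c) x = 0].
  by rewrite /x /edge_pt eE; exact: bary_segment.
(* the coordinate of [c] at [a + n] is [1 / dot n (c - a)] *)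
have k0 : 0 < - bary (p a) (p b) (p c) (p a + n).
  rewrite oppr_gt0; have := bary_normal n1 nab d0 (p a + n).
  rewrite addrAC subrr add0r n1 => h.
  by rewrite -(nmulr_lgt0 _ nc) h ltr01.
near=> e; rewrite KE; apply/ohull3P => //; rewrite !bary_line xa xb xc; split.
- by near: e; apply: near_right_affine_gt0; rewrite subr_gt0.
- by near: e; exact: near_right_affine_gt0.
- by rewrite add0r mulr_gt0 //; near: e; exact: nbhs_right_gt.
Unshelve. all: end_near. Qed.

(** The ray defining the trace runs inside the open cell ([inward_ray]). *)
Lemma trace_affine (v : R * R -> R) (k : R) (g : R * R) K F s :
  K \in cells -> F \in cell_edges cells K -> 0 < s < 1 ->
  (forall x, ohull p K x -> v x = k + dot g x) ->
  trace v (outward p nF K F) (edge_pt p F s) = k + dot g (edge_pt p F s).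
Proof.
move=> Kc FK s01 vE; set x := edge_pt p F s; set n := outward p nF K F.
apply: cvg_lim; first exact: norm_hausdorff.
apply: cvg_trans (_ : (k + (dot g x - e * dot g n)) @[e --> 0^'+] --> _).
  apply: near_eq_cvg; near=> e.
  rewrite vE; first by rewrite dotBr dotZr.
  by near: e; exact: inward_ray.
apply: cvg_at_right_filter.
rewrite -[X in _ --> X]addr0 -[in X in _ --> X]oppr0.
rewrite -[in X in _ --> X](mul0r (dot g n)) -addrA.
apply: cvgD; first exact: cvg_cst.
apply: cvgD; first exact: cvg_cst.
by apply: cvgN; apply: cvgMl; exact: cvg_id.
Unshelve. all: end_near. Qed.

End Traces.

(** * The two cells of an interior edge *)

Lemma cvg_ray {R : realType} (V : normedModType R) (x n : V) :
  (x + e *: n) @[e --> (0 : R)^'+] --> x.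
Proof.
apply: cvg_at_right_filter; rewrite -[X in _ --> X]addr0 -(scale0r n).
by apply: cvgD; [exact: cvg_cst | apply: cvgZr_tmp; exact: cvg_id].
Qed.

Arguments cvg_ray {R V} x n.

Section InteriorEdges.
Context {R : realType} {nv : nat}.
Variables (Omega : set (R * R)) (p : 'I_nv -> R * R).
Variables (cells : {set {set 'I_nv}}) (nF : {set 'I_nv} -> R * R).
Hypothesis mesh : triangulation Omega p cells.
Hypothesis normals : edge_normals p cells nF.
Local Open Scope set_scope.
Implicit Types (F K : {set 'I_nv}) (x n nu : R * R) (s e : R).

Let triangles K : K \in cells -> #|K| = 3%N /\ Defs.nondegenerate p K.
Proof. by case: mesh => h _ _; exact: h. Qed.

Let meet K K' : K \in cells -> K' \in cells ->
  (hull p K `&` hull p K' = hull p (K :&: K'))%classic.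
Proof. by case: mesh => _ _; apply. Qed.

Lemma interior_cell_edge F : F \in interior_edges Omega p cells ->
  exists2 K, K \in cells & F \in cell_edges cells K.
Proof.
rewrite inE => /andP[FE _]; move: (FE); rewrite inE => /andP[_].
by move=> /exists_inP[K Kc FK]; exists K => //; rewrite inE FE.
Qed.

(** The edge has a point off the boundary, possibly an endpoint; moving it
    slightly towards the midpoint keeps it in the open domain. *)
Lemma interior_edge_point F : F \in interior_edges Omega p cells ->
  exists2 s, 0 < s < 1 & interior Omega (edge_pt p F s).
Proof.
move=> Fi; have [K Kc FK] := interior_cell_edge Fi.
have [a [b [c [eE FE KE [ab bc ac] d0]]]] := cell_edgeP (triangles Kc) FK.
have F2 := card_cell_edge FK.
move: (Fi); rewrite inE => /andP[_ /asboolPn/existsNP[x /not_implyP[Fx]]].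
have [s [/andP[s0 s1] xE]] := hull2P F2 Fx.
have Kx : hull p K x.
  rewrite KE xE /edge_pt eE; apply/hull3P => //=.
  have [-> -> ->] := bary_segment s d0; rewrite lexx subr_ge0; split=> //.
have clx : closure Omega x.
  by case: mesh => _ -> _; exists K.
move=> nfx; have ox : interior Omega x.
  by apply: contrapT => nox; apply: nfx; split.
have ray e : edge_pt p F (s + e * (2^-1 - s)) =
    x + e *: (edge_pt p F 2^-1 - x).
  rewrite xE /edge_pt eE; apply: injective_projections;
    by rewrite /= /GRing.scale /=; field.
have : \forall e \near (0 : R)^'+,
    interior Omega (x + e *: (edge_pt p F 2^-1 - x)).
  exact: (cvg_ray x (edge_pt p F 2^-1 - x) _ (nbhs_interior ox)).
have lt1 : \forall e \near (0 : R)^'+, e < 1 by apply: nbhs_right_lt.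
have gt0 : \forall e \near (0 : R)^'+, 0 < e by apply: nbhs_right_gt.
move=> /(filterI gt0)/(filterI lt1)/filter_ex[e [e1 [e0 eO]]].
exists (s + e * (2^-1 - s)); last by rewrite ray.
have e1s : 0 <= (1 - e) * s by rewrite mulr_ge0 // subr_ge0 ltW.
have e1t : 0 <= (1 - e) * (1 - s) by rewrite mulr_ge0 ?subr_ge0 // ltW.
by apply/andP; split; lra.
Qed.

(** A closed triangle reached by points of a ray arbitrarily close to its origin
    contains the origin: a negative coordinate would stay negative nearby. *)
Lemma cell_closed_ray K x nu : K \in cells ->
  ~ (\forall e \near (0 : R)^'+, ~ hull p K (x - e *: nu)) -> hull p K x.
Proof.
move=> Kc; have [a [b [c [KE [ab bc ac] d0]]]] := cellP (triangles Kc).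
apply: contra_notP; rewrite KE => /(hull3P _ ab bc ac d0) Kx.
have near_neg (A B C : R * R) : ~ 0 <= bary A B C x ->
    \forall e \near (0 : R)^'+, ~ 0 <= bary A B C (x - e *: nu).
  move=> /negP; rewrite -ltNge -oppr_gt0 => k0.
  have := near_right_affine_gt0 (bary A B C (A + nu)) k0.
  by apply: filterS => e he; apply/negP; rewrite -ltNge bary_line; lra.
have nand : \forall e \near (0 : R)^'+,
    ~ [/\ 0 <= bary (p b) (p c) (p a) (x - e *: nu),
          0 <= bary (p c) (p a) (p b) (x - e *: nu)
        & 0 <= bary (p a) (p b) (p c) (x - e *: nu)].
  have [ha|/near_neg] := pselect (0 <= bary (p b) (p c) (p a) x); last first.
    by apply: filterS => e h [].
  have [hb|/near_neg] := pselect (0 <= bary (p c) (p a) (p b) x); last first.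
    by apply: filterS => e h [].
  have [hc|/near_neg] := pselect (0 <= bary (p a) (p b) (p c) x); last first.
    by apply: filterS => e h [].
  by case: Kx.
by apply: filterS nand => e h; apply: contra_not h => /(hull3P _ ab bc ac d0).
Qed.

(** Without hanging nodes a common point of two cells has all its weights on
    their common vertices, and both weights of an inner edge point are
    positive. *)
Lemma edge_pt_cell_sub K K' F s : K \in cells -> K' \in cells ->
  F \in cell_edges cells K -> 0 < s < 1 ->
  hull p K (edge_pt p F s) -> hull p K' (edge_pt p F s) -> F \subset K'.
Proof.
move=> Kc K'c FK /andP[s0 s1] Kx K'x.
have [a [b [c [eE FE KE [ab bc ac] d0]]]] := cell_edgeP (triangles Kc) FK.
have xKK' : hull p (K :&: K') (edge_pt p F s) by rewrite -meet.
have sKK' : K :&: K' \subset K by exact: subsetIl.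
have [xa xb _] := bary_segment s d0.
have xE : edge_pt p F s = (1 - s) *: p a + s *: p b by rewrite /edge_pt eE.
have KEa : K = [set b; c; a].
  by rewrite KE; apply/finset.setP => d; rewrite !inE -orbA orbC.
have KEb : K = [set c; a; b].
  by rewrite KE; apply/finset.setP => d; rewrite !inE orbC orbA.
have [ba ca cb] : [/\ b != a, c != a & c != b].
  by rewrite ![_ == a]eq_sym [c == b]eq_sym.
rewrite FE; apply/fintype.subsetP => d; rewrite !inE => /orP[]/eqP ->;
  apply: contraPT isT => dK'.
- have aKK' : a \notin K :&: K' by rewrite inE negb_and dK' orbT.
  have d0a : cross (p b) (p c) (p a) != 0 by rewrite crossC.
  move: sKK'; rewrite {2}KEa => /(bary_face0 bc ca ba d0a)/(_ aKK' xKK').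
  by rewrite xE xa => h; lra.
- have bKK' : b \notin K :&: K' by rewrite inE negb_and dK' orbT.
  have d0b : cross (p c) (p a) (p b) != 0 by rewrite 2!crossC.
  move: sKK'; rewrite {2}KEb => /(bary_face0 ca ab cb d0b)/(_ bKK' xKK').
  by rewrite xE xb => h; lra.
Qed.

(** Points slightly off the edge on the side of [- nu] lie in the domain, hence
    in cells; finitely many cells cannot all miss them, and a cell that meets
    them arbitrarily close to the edge has it as an edge, on that side. *)
Lemma interior_edge_side F nu : F \in interior_edges Omega p cells ->
  nu = nF F \/ nu = - nF F ->
  exists2 K, K \in cells & F \in cell_edges cells K /\ outward p nF K F = nu.
Proof.
move=> Fi nuE; have [s s01 sO] := interior_edge_point Fi.
set x := edge_pt p F s in sO.
have [K0 K0c FK0] := interior_cell_edge Fi.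
(* membership in the closed cell follows from the inward ray *)
have K0x : hull p K0 x.
  apply: (cell_closed_ray (nu := outward p nF K0 F)) => //.
  have := inward_ray triangles normals K0c FK0 s01.
  by move=> /filterI h /h/filter_ex[e [/ohull_sub_hull]].
have near_cover : \forall e \near (0 : R)^'+,
    exists K : {set 'I_nv}, K \in cells /\ hull p K (x - e *: nu).
  have : \forall e \near (0 : R)^'+, interior Omega (x + e *: - nu).
    exact: (cvg_ray x (- nu) _ (nbhs_interior sO)).
  apply: filterS => e eO; have := subset_closure (interior_subset eO).
  by case: mesh => _ -> _ [K Kc]; rewrite scalerN; exists K.
have [K [Kc Kfreq]] : exists K : {set 'I_nv}, K \in cells /\
    ~ \forall e \near (0 : R)^'+, ~ hull p K (x - e *: nu).
  apply: contrapT => /forallNP noK.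
  have : \forall e \near (0 : R)^'+, forall K : {set 'I_nv},
      ~ (K \in cells /\ hull p K (x - e *: nu)).
    apply: filter_forall => K; have [Kc|] := boolP (K \in cells).
      have /not_andP[//|/contrapT] := noK K.
      by apply: filterS => e nK [].
    by move=> nK; near=> e => -[].
  by move=> /(filterI near_cover)/filter_ex[e [[K ?] /(_ K)]].
have Kx : hull p K x by exact: cell_closed_ray Kfreq.
have FK : F \in cell_edges cells K.
  rewrite !inE (edge_pt_cell_sub K0c Kc FK0 s01 K0x Kx) andbT.
  by move: FK0; rewrite !inE => /andP[].
exists K => //; split=> //.
have [a [b [c [[eE FE KE [ab bc ac] d0]]]]] := outwardP triangles normals Kc FK.
move=> [n1 nab nc].
have [e [e0 Ke]] : exists e, 0 < e /\ hull p K (x - e *: nu).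
  apply: contrapT => /forallNP h; apply: Kfreq; near=> e => Ke.
  by apply: (h e); split=> //; near: e; exact: nbhs_right_gt.
rewrite KE in Ke; move: Ke => /(hull3P _ ab bc ac d0)[_ _ xc].
have xE : x = (1 - s) *: p a + s *: p b by rewrite /x /edge_pt eE.
have := bary_normal n1 nab d0 (x - e *: nu); set n := outward p nF K F in n1 nab nc *.
have -> : x - e *: nu - p a = s *: (p b - p a) - e *: nu.
  rewrite xE; apply: injective_projections; rewrite /= /GRing.scale /=; ring.
rewrite (dotBr _ (s *: _)) !dotZr nab mulr0 sub0r => be.
have nE : n = nu \/ n = - nu.
  have := outward_cases p nF K F; rewrite -/n.
  by move: nuE => [] -> [] ->; rewrite ?opprK; [left|right|right|left].
case: nE => // nN; have nuN : dot n nu = -1.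
  by rewrite -[nu]opprK -nN dotNr n1.
by have := mulr_ge0_le0 xc (ltW nc); rewrite be nuN mulrN1 opprK leNgt e0.
Unshelve. all: end_near. Qed.

(** Two cells on the same side of an edge overlap ([inward_ray]), whereas
    distinct cells meet only in their common face. *)
Lemma cell_unique_side K K' F : K \in cells -> K' \in cells ->
  F \in cell_edges cells K -> F \in cell_edges cells K' ->
  outward p nF K F = outward p nF K' F -> K = K'.
Proof.
move=> Kc K'c FK FK' nE.
have s01 : 0 < (2^-1 : R) < 1 by apply/andP; split; lra.
have := inward_ray triangles normals K'c FK' s01.
move=> /(filterI (inward_ray triangles normals Kc FK s01)).
rewrite nE => /filter_ex[e [Ky /ohull_sub_hull K'y]].
set y := edge_pt p F 2^-1 - _ in Ky K'y.
have yKK' : hull p (K :&: K') y.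
  by rewrite -meet //; split=> //; exact: ohull_sub_hull.
have [a [b [c [eE FE KE [ab bc ac] d0]]]] := cell_edgeP (triangles Kc) FK.
have cK' : c \in K'.
  apply: contraPT isT => cK'.
  have c0 : bary (p a) (p b) (p c) y = 0.
    apply: (bary_face0 (A := K :&: K')) => //.
      by rewrite -KE subsetIl.
    by rewrite inE negb_and cK' orbT.
  by move: Ky; rewrite KE => /(ohull3P _ ab bc ac d0)[_ _]; rewrite c0 ltxx.
have sKK' : K \subset K'.
  have sFK' : F \subset K' by move: FK'; rewrite !inE => /andP[].
  by rewrite KE finset.subUset -FE sFK' finset.sub1set.
apply/eqP; rewrite eqEcard sKK' /=.
by have [-> _] := triangles Kc; have [-> _] := triangles K'c.
Qed.

Lemma sum_interior_edges (V : nmodType)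
    (G : {set 'I_nv} -> {set 'I_nv} -> V) :
  \sum_(K in cells) \sum_(F in cell_edges cells K :&: interior_edges Omega p cells)
    G K F =
  \sum_(F in interior_edges Omega p cells)
    \sum_(K in cells | F \in cell_edges cells K) G K F.
Proof.
rewrite (exchange_big_dep (mem (interior_edges Omega p cells))) /=.
  by apply: eq_bigr => F Fi; apply: eq_bigl => K; rewrite inE Fi andbT.
by move=> K F _; rewrite inE => /andP[].
Qed.

(** The cell [Km] is the one from which the trace [^-] is taken, and [Kp] the one
    for [^+]; summing over the cells at the edge is summing over these two. *)
Lemma interior_edge_cells F : F \in interior_edges Omega p cells ->
  exists Km Kp, [/\ Km \in cells /\ Kp \in cells,
    F \in cell_edges cells Km /\ F \in cell_edges cells Kp,
    outward p nF Km F = nF F /\ outward p nF Kp F = - nF F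
  & forall (V : nmodType) (G : {set 'I_nv} -> V),
    \sum_(K in cells | F \in cell_edges cells K) G K = G Km + G Kp].
Proof.
move=> Fi; have [Km Kmc [FKm om]] := interior_edge_side Fi (or_introl erefl).
have [Kp Kpc [FKp op]] := interior_edge_side Fi (or_intror erefl).
exists Km, Kp; split=> // V G.
have Kmp : Kp != Km.
  apply: contraPneq isT => h; move: op; rewrite h om => /eqP.
  rewrite -addr_eq0 => /eqP n0.
  have /andP[FE _] : (F \in edges cells) && (F \subset Km).
    by move: FKm; rewrite inE.
  have [n1 _] := normals FE.
  have : dot (nF F + nF F) (nF F) = 0 by rewrite n0 /dot /= !mul0r addr0.
  by rewrite dotC dotDr n1; lra.
rewrite (bigD1 Km) /=; last by rewrite Kmc.
congr (_ + _); rewrite (bigD1 Kp) /=; last by rewrite Kpc FKp.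
rewrite big1 ?addr0 // => K /andP[/andP[/andP[Kc FK] nKm] nKp].
have [ho|ho] := outward_cases p nF K F.
  by move: nKm; rewrite (cell_unique_side Kc Kmc FK FKm) ?eqxx // om ho.
by move: nKp; rewrite (cell_unique_side Kc Kpc FK FKp) ?eqxx // op ho.
Qed.

End InteriorEdges.

(** * Linearity of real-valued integrals *)

Section RealIntegrals.
Context {R : realType} d {T : measurableType d} (mu : {measure set T -> \bar R}).
Variable D : set T.
Hypothesis mD : measurable D.
Implicit Types f h : T -> R.

Lemma integrable_scale k f :
  mu.-integrable D (EFin \o f) -> mu.-integrable D (EFin \o (fun x => k * f x)).
Proof. by move=> /(integrableZl mD k); apply: eq_integrable => // x _. Qed.

Lemma integrable_add f1 f2 : mu.-integrable D (EFin \o f1) ->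
  mu.-integrable D (EFin \o f2) ->
  mu.-integrable D (EFin \o (fun x => f1 x + f2 x)).
Proof. by move=> i1 i2; apply: eq_integrable (integrableD mD i1 i2). Qed.

Lemma integrable_mul_bounded f h : mu.-integrable D (EFin \o f) ->
  measurable_fun D h -> [bounded h x | x in D] ->
  mu.-integrable D (EFin \o (fun x => f x * h x)).
Proof. by move=> fi mh bh; apply: eq_integrable (integrableMl mD fi mh bh). Qed.

Lemma integrable_dot (b : T -> R * R) g :
  mu.-integrable D (EFin \o (fun x => (b x).1)) ->
  mu.-integrable D (EFin \o (fun x => (b x).2)) ->
  mu.-integrable D (EFin \o (fun x => dot (b x) g)).
Proof.
move=> i1 i2.
have := integrable_add (integrable_scale g.1 i1) (integrable_scale g.2 i2).
by apply: eq_integrable => // x _; rewrite /dot /= !(mulrC g.1) !(mulrC g.2).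
Qed.

Lemma integrable_max0 f : mu.-integrable D (EFin \o f) ->
  mu.-integrable D (EFin \o (fun x => Num.max 0 (f x))).
Proof.
move=> fi; apply: (le_integrable mD _ _ fi).
  apply/measurable_EFinP; apply: measurable_maxr; first exact: measurable_cst.
  by apply/measurable_EFinP; exact: measurable_int fi.
move=> x _ /=; rewrite lee_fin /Num.max; case: ifP => _ //.
by rewrite normr0.
Qed.

Lemma integrable_min0 f : mu.-integrable D (EFin \o f) ->
  mu.-integrable D (EFin \o (fun x => Num.min 0 (f x))).
Proof.
move=> fi; have := integrable_scale (-1) (integrable_max0 (integrable_scale (-1) fi)).
apply: eq_integrable => // x _ /=; congr (_%:E).
by rewrite !mulN1r -[X in Num.max X _]oppr0 -oppr_min opprK.
Qed.

Lemma Rintegral_sum (I : Type) (r : seq I) (f : I -> T -> R) :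
  (forall i, mu.-integrable D (EFin \o f i)) ->
  \sum_(i <- r) \int[mu]_(x in D) f i x = \int[mu]_(x in D) \sum_(i <- r) f i x.
Proof.
move=> fi; elim: r => [|i r IHr].
  by rewrite big_nil /Rintegral integral0_eq // => x _; rewrite big_nil.
rewrite big_cons IHr; under [RHS]eq_Rintegral do rewrite big_cons.
rewrite RintegralD //; apply: eq_integrable (integrable_sum mD r (fun i _ => fi i)) => //.
by move=> x _; rewrite /= sumEFin.
Qed.

Lemma ae_eq_Rintegral f h (Q : T -> Prop) : mu.-integrable D (EFin \o f) ->
  mu.-integrable D (EFin \o h) -> {ae mu, forall x, Q x} ->
  (forall x, D x -> Q x -> f x = h x) ->
  \int[mu]_(x in D) f x = \int[mu]_(x in D) h x.
Proof.
move=> fi hi aeQ fh; rewrite /Rintegral; congr fine; apply: ae_eq_integral => //.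
- exact: measurable_int fi.
- exact: measurable_int hi.
- by apply: filterS aeQ => x Qx Dx /=; rewrite fh.
Qed.

End RealIntegrals.

(** * Affine functions on cells and edges *)

Section CellAffine.
Context {R : realType} {nv : nat}.
Variables (p : 'I_nv -> R * R) (cells : {set {set 'I_nv}}).
Hypothesis triangles : forall K, K \in cells -> #|K| = 3%N /\ Defs.nondegenerate p K.
Implicit Types (F K : {set 'I_nv}) (x g : R * R) (s k : R).

Lemma open_ohull K : K \in cells -> open (ohull p K).
Proof.
move=> Kc; have [a [b [c [KE [ab bc ac] d0]]]] := cellP (triangles Kc).
have bary_cont (A B C : R * R) : continuous (bary A B C).
  move=> x; rewrite /bary /cross; apply: cvgMl; apply: cvgB; apply: cvgM => //;
    try exact: cvg_cst; apply: cvgB; try exact: cvg_cst; [exact: cvg_snd|exact: cvg_fst].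
have -> : ohull p K = bary (p b) (p c) (p a) @^-1` [set t | 0 < t] `&`
   (bary (p c) (p a) (p b) @^-1` [set t | 0 < t] `&`
    bary (p a) (p b) (p c) @^-1` [set t | 0 < t]).
  rewrite KE; apply/seteqP; split=> x.
    by move=> /(ohull3P _ ab bc ac d0)[].
  by move=> [xa [xb xc]]; apply/(ohull3P _ ab bc ac d0).
have opre (A B C : R * R) : open (bary A B C @^-1` [set t | 0 < t]).
  by apply: open_comp => [x _|]; [exact: bary_cont|exact: open_gt].
by apply: openI; [|apply: openI].
Qed.

(** The carrier [measurableTypeR R] fixes the sigma-algebra for which the Lebesgue
    measure, and hence the integrals over cells and edges, are defined. *)
Lemma measurable_affine k g
    (D : set (measurableTypeR R * measurableTypeR R)) :
  measurable_fun D (fun x => k + dot g x).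
Proof.
suff : measurable_fun (D : set (R * R)) (fun x => k + dot g x) by [].
apply: measurable_funTS; apply: measurable_funD; first exact: measurable_cst.
by apply: measurable_funD; apply: measurable_funM => //.
Qed.

Lemma measurable_ohull K : K \in cells ->
  measurable (ohull p K : set (measurableTypeR R * measurableTypeR R)).
Proof.
suff : K \in cells -> measurable (ohull p K) by [].
move=> Kc; have [a [b [c [KE [ab bc ac] d0]]]] := cellP (triangles Kc).
have bary_meas (A B C : R * R) : measurable_fun setT (bary A B C).
  have -> : bary A B C = fun x : R * R =>
     - (dot (- (B - A).2, (B - A).1) A) / cross A B C +
     dot ((cross A B C)^-1 *: (- (B - A).2, (B - A).1)) x.
    by apply/funext => x; rewrite /bary /dot {1}/cross /= /GRing.scale /=; ring.
  exact: measurable_affine.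
have -> : ohull p K = bary (p b) (p c) (p a) @^-1` `]0, +oo[ `&`
   (bary (p c) (p a) (p b) @^-1` `]0, +oo[ `&`
    bary (p a) (p b) (p c) @^-1` `]0, +oo[).
  rewrite KE; apply/seteqP; split=> x.
    move=> /(ohull3P _ ab bc ac d0)[xa xb xc].
    by rewrite /= !in_itv /= !andbT.
  rewrite /= !in_itv /= !andbT => -[xa [xb xc]].
  by apply/(ohull3P _ ab bc ac d0).
have mpre (A B C : R * R) : measurable (bary A B C @^-1` `]0, +oo[).
  by rewrite -[X in measurable X]setTI; apply: bary_meas.
by apply: measurableI; [|apply: measurableI].
Qed.

(** On a triangle an affine function averages its values at the vertices. *)
Lemma bounded_affine_cell k g K :
  K \in cells -> [bounded (k + dot g x) | x in ohull p K].
Proof.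
move=> Kc; have [a [b [c [KE [ab bc ac] d0]]]] := cellP (triangles Kc).
pose f x := k + dot g x.
exists (`|f (p a)| + `|f (p b)| + `|f (p c)|); split; first exact: num_real.
move=> M Mgt x /=; rewrite KE => /(ohull3P _ ab bc ac d0)[xa xb xc].
apply: le_trans (ltW Mgt); have := bary_sum x d0.
move: (bary_decomposition x d0) xa xb xc.
set u := bary _ _ _ _; set v := bary _ _ _ _; set w := bary _ _ _ _.
move=> -> u0 v0 w0 uvw.
have -> : k + dot g (u *: p a + v *: p b + w *: p c) =
    u * f (p a) + v * f (p b) + w * f (p c).
  rewrite !dotDr !dotZr /f !mulrDr -[X in X + _ = _](mul1r k) -uvw; ring.
have le1 t y : 0 < t -> t <= 1 -> `|t * y| <= `|y|.
  by move=> t0 t1; rewrite normrM gtr0_norm // ler_piMl.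
apply: le_trans (ler_normD _ _) _; apply: lerD; last by apply: le1; lra.
by apply: le_trans (ler_normD _ _) _; apply: lerD; apply: le1; lra.
Qed.

Lemma grad_affine k g (v : R * R -> R) K x : K \in cells ->
  (forall y, ohull p K y -> v y = k + dot g y) -> ohull p K x -> grad v x = g.
Proof.
move=> Kc vE Kx.
have dirE (e : R * R) : 'D_e v x = dot g e.
  have -> : 'D_e v x = 'D_e (fun y : R * R => k + dot g y) x.
    apply: near_eq_derive; have := open_ohull Kc; rewrite openE => /(_ _ Kx).
    by apply: filterS => y /vE.
  rewrite /derive; apply: cvg_lim; first exact: norm_hausdorff.
  apply: cvg_trans (_ : dot g e @[h --> (0 : R)^'] --> _); last exact: cvg_cst.
  apply: near_eq_cvg; near=> h.
  have h0 : h != 0 by near: h; exact: nbhs_dnbhs_neq.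
  rewrite /GRing.scale /= dotDr dotZr; by field.
rewrite /grad !dirE /dot /= !mulr1 !mulr0 addr0 add0r.
by case: (g).
Unshelve. all: end_near. Qed.

Lemma edge_pt_affine F k g : exists k0 k1, forall s,
  k + dot g (edge_pt p F s) = k0 + k1 * s.
Proof.
exists (k + dot g (endpoints p F).1).
exists (dot g (endpoints p F).2 - dot g (endpoints p F).1) => s.
by rewrite /edge_pt dotDr !dotZr; ring.
Qed.

Lemma measurable_affine_edge F k g (D : set (measurableTypeR R)) :
  measurable_fun D (fun s => k + dot g (edge_pt p F s)).
Proof.
suff : measurable_fun (D : set R) (fun s => k + dot g (edge_pt p F s)) by [].
have [k0 [k1 e]] := edge_pt_affine F k g.
under eq_fun do rewrite e.
by apply: measurable_funTS; apply: measurable_funD => //; apply: measurable_funM.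
Qed.

Lemma bounded_affine_edge F k g :
  [bounded (k + dot g (edge_pt p F s)) | s in `]0, 1[].
Proof.
have [k0 [k1 e]] := edge_pt_affine F k g.
exists (`|k0| + `|k1|); split; first exact: num_real.
move=> M Mgt s /=; rewrite in_itv /= => /andP[s0 s1].
apply: le_trans (ltW Mgt); rewrite e; apply: le_trans (ler_normD _ _) _.
by rewrite lerD2l normrM (gtr0_norm s0) ler_piMr // ltW.
Qed.

End CellAffine.

(** * The basis functions sum to one *)

Section PartitionOfUnity.
Context {R : realType} {nv : nat}.
Variables (Omega : set (R * R)) (p : 'I_nv -> R * R).
Variables (cells : {set {set 'I_nv}}) (nF : {set 'I_nv} -> R * R).
Variable phi : 'I_#|edges cells| -> R * R -> R.
Hypothesis triangles : forall K, K \in cells -> #|K| = 3%N /\ Defs.nondegenerate p K.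
Hypothesis normals : edge_normals p cells nF.
Hypothesis basis : CR_basis Omega p nF phi.
Implicit Types (F K : {set 'I_nv}) (s : R).

Lemma midpoint_edge_pt F : #|F| = 2%N -> midpoint p F = edge_pt p F 2^-1.
Proof.
move=> /(endpointsP p)[a [b [ab FE eE]]].
rewrite /midpoint /edge_pt eE FE sum_set2 //.
by apply: injective_projections; rewrite /= /GRing.scale /=; field.
Qed.

(** The basis functions and their sum are affine on a cell, and the sum is 1 at
    the midpoints of the three edges; as these are not collinear, it is
    the constant 1. *)
Lemma CR_affine K : K \in cells ->
  exists (c : 'I_#|edges cells| -> R) (g : 'I_#|edges cells| -> R * R),
  [/\ forall i x, ohull p K x -> phi i x = c i + dot (g i) x,
      \sum_i c i = 1 & \sum_i g i = 0].
Proof.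
move=> Kc.
have /choice[cg cgE] : forall i, exists cg : R * (R * R),
    forall x, ohull p K x -> phi i x = cg.1 + dot cg.2 x.
  move=> i; have [[/(_ K Kc)[c [g h]] _] _] := basis i.
  by exists (c, g).
exists (fun i => (cg i).1), (fun i => (cg i).2).
set C := \sum_i _; set G := \sum_i _.
have mid F : F \in cell_edges cells K -> C + dot G (midpoint p F) = 1.
  move=> FK; have FE : F \in edges cells by move: FK; rewrite inE => /andP[].
  pose j := enum_rank_in FE F.
  have jE : edge_of j = F by rewrite /edge_of enum_rankK_in.
  have val i : (cg i).1 + dot (cg i).2 (midpoint p F) = (i == j)%:R.
    have [_ /(_ j K Kc)] := basis i; rewrite jE => <-; last first.
      by move: FK; rewrite inE => /andP[].
    have F2 := card_cell_edge FK.
    rewrite midpoint_edge_pt // (trace_affine triangles normals Kc FK _ (cgE i)) //.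
    by apply/andP; split; lra.
  have -> : dot G (midpoint p F) = \sum_i dot (cg i).2 (midpoint p F).
    rewrite /G; elim/big_rec2: _ => [|i y z _ <-]; first by rewrite /dot /=; ring.
    by rewrite /dot /=; ring.
  rewrite -big_split /=; under eq_bigr do rewrite val.
  rewrite (bigD1 j) //= eqxx big1 ?addr0 // => i ij.
  by rewrite (negbTE ij).
have [a [b [c [KE [ab bc ac] d0]]]] := cellP (triangles Kc).
have edge a' b' : a' != b' -> a' \in K -> b' \in K ->
    C + dot G (2^-1 *: (p a' + p b')) = 1.
  move=> a'b' aK bK; rewrite -(sum_set2 p a'b'); apply: mid.
  have sK : [set a'; b']%SET \subset K.
    by apply/fintype.subsetP => d; rewrite !inE => /orP[]/eqP ->.
  rewrite !inE sK cards2 a'b' andbT /=.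
  by apply/existsP; exists K; rewrite Kc.
have {}edge a' b' : a' != b' -> a' \in K -> b' \in K ->
    C + 2^-1 * (dot G (p a') + dot G (p b')) = 1.
  by move=> *; rewrite -dotDr -dotZr edge.
have aK : a \in K by rewrite KE !inE eqxx.
have bK : b \in K by rewrite KE !inE eqxx orbT.
have cK : c \in K by rewrite KE !inE eqxx orbT.
have eab := edge _ _ ab aK bK; have ebc := edge _ _ bc bK cK.
have eac := edge _ _ ac aK cK.
have Gba : dot G (p b - p a) = 0 by rewrite dotBr; lra.
have Gca : dot G (p c - p a) = 0 by rewrite dotBr; lra.
have G0 : G = 0.
  apply: injective_projections => /=; apply: (mulfI d0); rewrite mulr0.
    have -> : cross (p a) (p b) (p c) * G.1 =
      dot G (p b - p a) * (p c - p a).2 - dot G (p c - p a) * (p b - p a).2.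
      by rewrite /cross /dot /=; ring.
    by rewrite Gba Gca !mul0r subrr.
  have -> : cross (p a) (p b) (p c) * G.2 =
      dot G (p c - p a) * (p b - p a).1 - dot G (p b - p a) * (p c - p a).1.
    by rewrite /cross /dot /=; ring.
  by rewrite Gba Gca !mul0r subrr.
split=> //; move: eab; rewrite G0 /dot /= !mul0r !addr0 mulr0 addr0.
by [].
Qed.

Lemma sum_affine_eq1 (c : 'I_#|edges cells| -> R) (g : 'I_#|edges cells| -> R * R) x :
  \sum_i c i = 1 -> \sum_i g i = 0 -> \sum_i (c i + dot (g i) x) = 1.
Proof.
move=> c1 g0; rewrite big_split /= c1.
have -> : \sum_i dot (g i) x = dot (\sum_i g i) x.
  elim/big_rec2: _ => [|i y z _ ->]; first by rewrite /dot /=; ring.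
  by rewrite /dot /=; ring.
by rewrite g0 /dot /= !mul0r !addr0.
Qed.

End PartitionOfUnity.

(** * Row sums of the transport matrix *)

Section RowSums.
Context {R : realType} {nv : nat}.
Variables (Omega : set (R * R)) (p : 'I_nv -> R * R).
Variables (cells : {set {set 'I_nv}}) (nF : {set 'I_nv} -> R * R).
Variable phi : 'I_#|edges cells| -> R * R -> R.
Variable b : R * R -> R * R.
Hypothesis mesh : triangulation Omega p cells.
Hypothesis normals : edge_normals p cells nF.
Hypothesis basis : CR_basis Omega p nF phi.
Hypothesis b_cells : forall K, K \in cells ->
  cell_integrable p K (fun x => (b x).1) /\ cell_integrable p K (fun x => (b x).2).
Hypothesis b_edges : forall K F, K \in cells -> F \in cell_edges cells K ->
  edge_integrable p F (fun x => (trace b (outward p nF K F) x).1) /\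
  edge_integrable p F (fun x => (trace b (outward p nF K F) x).2).
Hypothesis b_normal : forall F, F \in interior_edges Omega p cells ->
  edge_ae p F (fun x => dot (vminus nF b F x) (nF F) = dot (vplus nF b F x) (nF F)).
Implicit Types (F K : {set 'I_nv}) (s : R).

Let triangles K : K \in cells -> #|K| = 3%N /\ Defs.nondegenerate p K.
Proof. by case: mesh => h _ _; exact: h. Qed.

(** On each cell the form is linear in the constant gradient of its first
    argument, and the gradients of the basis functions cancel. *)
Lemma a_form_sum0 v : CR_space Omega p cells nF v ->
  \sum_j a_form p cells b (phi j) v = 0.
Proof.
move=> [v_aff _]; rewrite /a_form exchange_big /=; apply: big1 => K Kc.
have [k [h vE]] := v_aff K Kc.
have [c [g [phiE c1 g0]]] := CR_affine triangles normals basis Kc.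
have mK := measurable_ohull triangles Kc.
have [b1 b2] := b_cells Kc.
have mul_int (f : R * R -> R) : cell_integrable p K f ->
    cell_integrable p K (fun x => f x * (k + dot h x)).
  move=> fi; apply: (integrable_mul_bounded mK fi).
    exact: measurable_affine.
  exact: (bounded_affine_cell triangles).
have [i1 i2] := (mul_int _ b1, mul_int _ b2).
have cellE j : cell_int p K (fun x => dot (b x) (grad (phi j) x) * v x) =
    (g j).1 * cell_int p K (fun x => (b x).1 * (k + dot h x)) +
    (g j).2 * cell_int p K (fun x => (b x).2 * (k + dot h x)).
  rewrite /cell_int -!RintegralZl // -RintegralD //; last 2 first.
  - exact: (integrable_scale mK).
  - exact: (integrable_scale mK).
  apply: eq_Rintegral => x; rewrite inE => Kx.
  rewrite (grad_affine triangles Kc (phiE j) Kx) vE // /dot; ring.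
under eq_bigr do rewrite cellE.
rewrite big_split /= -!mulr_suml.
have -> : \sum_j (g j).1 = (\sum_j g j).1 by rewrite raddf_sum.
have -> : \sum_j (g j).2 = (\sum_j g j).2 by rewrite raddf_sum.
by rewrite g0 !mul0r addr0.
Qed.

Let mI : measurable (`]0, 1[%classic : set (measurableTypeR R)).
Proof. exact: measurable_itv. Qed.

Lemma edge_int_sum F (f : 'I_#|edges cells| -> R * R -> R) :
  (forall j, edge_integrable p F (f j)) ->
  \sum_j edge_int p F (f j) = edge_int p F (fun x => \sum_j f j x).
Proof.
move=> fi; rewrite /edge_int -mulr_sumr; congr (_ * _).
by rewrite (@Rintegral_sum _ _ _ _ _ mI _ _ (fun j s => f j (edge_pt p F s))).
Qed.

Lemma eq_edge_int F f h : (forall s, 0 < s < 1 -> f (edge_pt p F s) = h (edge_pt p F s)) ->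
  edge_int p F f = edge_int p F h.
Proof.
move=> fh; rewrite /edge_int; congr (_ * _); apply: eq_Rintegral => s.
by rewrite inE /= in_itv /= => /fh.
Qed.

Lemma eq_edge_integrable F f h :
  (forall s, 0 < s < 1 -> f (edge_pt p F s) = h (edge_pt p F s)) ->
  edge_integrable p F f -> edge_integrable p F h.
Proof.
move=> fh; apply: eq_integrable => // s.
by rewrite inE /= in_itv /= => /fh ->.
Qed.

Lemma edge_integrable_affineM F f k g : edge_integrable p F f ->
  edge_integrable p F (fun x => f x * (k + dot g x)).
Proof.
move=> fi; apply: (integrable_mul_bounded mI fi).
  exact: measurable_affine_edge.
exact: bounded_affine_edge.
Qed.

(** Regrouped by interior edges, with [fm] and [fp] the outward fluxes of the two
    cells, the sum of the basis functions is 1 on both sides and leaves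
    [fm v^- + fp v^+ - fm (v^- - v^+)], which integrates to zero because
    [fp = - fm] almost everywhere. *)
Lemma b_form_sum0 v : CR_space Omega p cells nF v ->
  \sum_j b_form Omega p cells nF b (phi j) v = 0.
Proof.
move=> [v_aff _]; rewrite /b_form.
under eq_bigr do rewrite (sum_interior_edges Omega p) -sumrB.
rewrite exchange_big /=; apply: big1 => F Fi.
have [Km [Kp [[Kmc Kpc] [FKm FKp] [nm np] sumE]]] :=
  interior_edge_cells mesh normals Fi.
under eq_bigr do rewrite sumE nm np.
have [km [hm vmE]] := v_aff Km Kmc; have [kp [hp vpE]] := v_aff Kp Kpc.
have [cm [gm [pmE cm1 gm0]]] := CR_affine triangles normals basis Kmc.
have [cp [gp [ppE cp1 gp0]]] := CR_affine triangles normals basis Kpc.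
have tm (w : R * R -> R) k g s : (forall x, ohull p Km x -> w x = k + dot g x) ->
    0 < s < 1 -> trace w (nF F) (edge_pt p F s) = k + dot g (edge_pt p F s).
  by move=> wE s01; have := trace_affine triangles normals Kmc FKm s01 wE; rewrite nm.
have tp (w : R * R -> R) k g s : (forall x, ohull p Kp x -> w x = k + dot g x) ->
    0 < s < 1 -> trace w (- nF F) (edge_pt p F s) = k + dot g (edge_pt p F s).
  by move=> wE s01; have := trace_affine triangles normals Kpc FKp s01 wE; rewrite np.
pose fm x := dot (trace b (nF F) x) (nF F).
pose fp x := dot (trace b (- nF F) x) (- nF F).
have fmi : edge_integrable p F fm.
  have := b_edges Kmc FKm; rewrite nm => -[i1 i2]; exact: (integrable_dot mI).
have fpi : edge_integrable p F fp.
  have := b_edges Kpc FKp; rewrite np => -[i1 i2]; exact: (integrable_dot mI).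
pose lm x := km + dot hm x; pose lp x := kp + dot hp x.
pose um j x := cm j + dot (gm j) x; pose up j x := cp j + dot (gp j) x.
have term1 j : edge_int p F (fun x =>
      fm x * (trace (phi j) (nF F) x : R) * (trace v (nF F) x : R)) =
    edge_int p F (fun x => fm x * um j x * lm x).
  by apply: eq_edge_int => s s01; rewrite (tm _ _ _ _ (pmE j)) // (tm _ _ _ _ vmE).
have term2 j : edge_int p F (fun x =>
      fp x * (trace (phi j) (- nF F) x : R) * (trace v (- nF F) x : R)) =
    edge_int p F (fun x => fp x * up j x * lp x).
  by apply: eq_edge_int => s s01; rewrite (tp _ _ _ _ (ppE j)) // (tp _ _ _ _ vpE).
(* integrand of the upwind term, with the affine expressions of the traces *)
pose w j x := (um j x * Num.max 0 (fm x) + up j x * Num.min 0 (fm x)) * - (lp x - lm x).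
have term3 j : edge_int p F (fun x => upwind nF b (phi j) F x * - jump nF v F x) =
    edge_int p F (w j).
  apply: eq_edge_int => s s01; rewrite /upwind /jump /flux /vplus /vminus.
  rewrite (tm _ _ _ _ (pmE j)) // (tm _ _ _ _ vmE) //.
  by rewrite (tp _ _ _ _ (ppE j)) // (tp _ _ _ _ vpE).
under eq_bigr do rewrite term1 term2 term3.
have fm_lm : edge_integrable p F (fun x => fm x * lm x).
  exact: edge_integrable_affineM.
have fm_lp : edge_integrable p F (fun x => - fm x * lp x).
  apply: edge_integrable_affineM.
  apply: (eq_edge_integrable (f := fun x => -1 * fm x)) => [s _|].
    by rewrite mulN1r.
  exact: (integrable_scale mI (-1) fmi).
have fp_lp : edge_integrable p F (fun x => fp x * lp x).
  exact: edge_integrable_affineM.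
have wi j : edge_integrable p F (w j).
  have i1 : edge_integrable p F (fun x => Num.max 0 (fm x) * um j x).
    by apply: edge_integrable_affineM; exact: (integrable_max0 mI fmi).
  have i2 : edge_integrable p F (fun x => Num.min 0 (fm x) * up j x).
    by apply: edge_integrable_affineM; exact: (integrable_min0 mI fmi).
  pose u x := Num.max 0 (fm x) * um j x + Num.min 0 (fm x) * up j x.
  have ui : edge_integrable p F u by exact: (integrable_add mI i1 i2).
  have := edge_integrable_affineM (km - kp) (hm - hp) ui.
  apply: eq_edge_integrable => s _.
  by rewrite /w /u /um /up /lm /lp /dot /=; ring.
rewrite sumrB big_split /= !edge_int_sum //; last 2 first.
- move=> j; apply: edge_integrable_affineM.
  exact: edge_integrable_affineM.
- move=> j; apply: edge_integrable_affineM.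
  exact: edge_integrable_affineM.
have um1 x : \sum_j um j x = 1 by exact: sum_affine_eq1.
have up1 x : \sum_j up j x = 1 by exact: sum_affine_eq1.
rewrite (eq_edge_int (h := fun x => fm x * lm x)); last first.
  by move=> s _; rewrite -mulr_suml -mulr_sumr um1 mulr1.
rewrite [X in _ + X - _](eq_edge_int (h := fun x => fp x * lp x)); last first.
  by move=> s _; rewrite -mulr_suml -mulr_sumr up1 mulr1.
rewrite [X in _ - X](eq_edge_int (h := fun x => fm x * lm x + - fm x * lp x)); last first.
  move=> s _; rewrite /w -mulr_suml big_split /= -!mulr_suml um1 up1 !mul1r.
  by rewrite addr_max_min add0r; ring.
have -> : edge_int p F (fun x => fp x * lp x) = edge_int p F (fun x => - fm x * lp x).
  rewrite /edge_int; congr (_ * _); apply: (ae_eq_Rintegral mI fp_lp fm_lp (b_normal Fi)) => s.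
  rewrite /= in_itv /= => s01 /(_ s01).
  by rewrite /fp /fm dotNr /vminus /vplus => ->.
by rewrite /edge_int RintegralD // mulrDr subrr.
Qed.

End RowSums.

(** * Area of plane sets *)

Section PlaneArea.
Context {R : realType}.
Notation plane := (measurableTypeR R * measurableTypeR R)%type.

Lemma ball_plane (x : R * R) r : ball x r = ball x.1 r `*` ball x.2 r.
Proof. by []. Qed.

Lemma measurable_ball_plane (x : R * R) r : measurable (ball x r : set plane).
Proof. by rewrite ball_plane; apply: measurableX; exact: measurable_ball. Qed.

Lemma area_ball (x : R * R) r : 0 <= r ->
  area (ball x r) = ((r *+ 2) * (r *+ 2))%:E.
Proof.
move=> r0; rewrite ball_plane /area product_measure1E; last 2 first.
- exact: measurable_ball.
- exact: measurable_ball.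
by rewrite /= !lebesgue_measure_ball.
Qed.

(** An open set is the union of the squares with rational centres and radii
    [1 / (n + 1)] that it contains, and there are countably many of these. *)
Lemma open_measurable_plane (U : set (R * R)) :
  open U -> measurable (U : set plane).
Proof.
move=> oU.
pose box (t : rat * rat * nat) : set (R * R) :=
  ball ((ratr t.1.1, ratr t.1.2) : R * R) (t.2.+1%:R^-1).
pose G t : set plane := if `[< box t `<=` U >] then box t else set0.
have -> : (U : set plane) = \bigcup_t G t.
  apply/seteqP; split=> [x Ux|x [t _]]; last first.
    by rewrite /G; case: asboolP => // + tx; apply.
  have : nbhs x U by apply: open_nbhs_nbhs.
  move=> /nbhs_ballP[e /= e0 eU].
  have [n ne] : exists n : nat, n.+1%:R^-1 < e / 2.
    have e2 : 0 < e / 2 by rewrite divr_gt0.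
    have := near_infty_natSinv_lt (PosNum e2).
    by move=> /filter_ex[n /= ?]; exists n.
  pose r : R := n.+1%:R^-1.
  have {}ne : r < e / 2 := ne.
  have r0 : 0 < r by rewrite invr_gt0.
  have lt1 (y : R) : y - r < y + r by lra.
  have [q1 q1x] := rat_in_itvoo (lt1 x.1).
  have [q2 q2x] := rat_in_itvoo (lt1 x.2).
  have near_q (q : rat) (y z : R) : ratr q \in `]y - r, y + r[ ->
      ball (ratr q : R) r z -> ball y e z.
    rewrite in_itv /= => /andP[qy1 qy2]; rewrite !ball_itv /= !in_itv /=.
    move=> /andP[z1 z2]; apply/andP; split; lra.
  exists (q1, q2, n) => //; rewrite /G asboolT.
    move: q1x q2x; rewrite /box ball_plane /= !in_itv /= => /andP[? ?] /andP[? ?].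
    by split; rewrite /= ball_itv /= in_itv /= -/r; apply/andP; split; lra.
  move=> y; rewrite /box ball_plane /= => -[y1 y2]; apply: eU.
  by split; [exact: near_q q1x y1 | exact: near_q q2x y2].
apply: countable_bigcupT_measurable => // t; rewrite /G; case: ifP => _ //.
exact: measurable_ball_plane.
Qed.

Lemma closed_measurable_plane (U : set (R * R)) :
  closed U -> measurable (U : set plane).
Proof.
move=> /closed_openC/open_measurable_plane/measurableC.
by rewrite setCK.
Qed.

Lemma area_gt0 (A : set (R * R)) (x : R * R) : measurable (A : set plane) ->
  nbhs x A -> (0 < area A)%E.
Proof.
move=> mA /nbhs_ballP[r /= r0 rA].
apply: (@lt_le_trans _ _ (area (ball x r))).
  by rewrite area_ball ?ltW // lte_fin mulr_gt0 // mulrn_wgt0.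
by apply: le_measure => //; rewrite inE //; exact: measurable_ball_plane.
Qed.

Lemma area_bounded (A : set (R * R)) M : measurable (A : set plane) ->
  A `<=` [set x | `|x| <= M] -> (area A < +oo)%E.
Proof.
move=> mA AM; have [M0|M0] := leP 0 M; last first.
  rewrite (_ : A = set0) ?/area ?measure0 // -subset0 => x /AM /=.
  by rewrite leNgt (lt_le_trans M0).
apply: (@le_lt_trans _ _ (area (ball (0 : R * R) (M + 1)))).
  apply: le_measure; rewrite ?inE //; first exact: measurable_ball_plane.
  by move=> x /AM /= xM; rewrite -ball_normE /= sub0r normrN; lra.
by rewrite area_ball ?ltry // addr_ge0.
Qed.

End PlaneArea.

(** * Positivity of the lumped masses *)

Section Masses.
Context {R : realType} {nv : nat}.
Variables (Omega : set (R * R)) (p : 'I_nv -> R * R).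
Variables (cells : {set {set 'I_nv}}) (nF : {set 'I_nv} -> R * R).
Variable phi : 'I_#|edges cells| -> R * R -> R.
Hypothesis triangles : forall K, K \in cells -> #|K| = 3%N /\ Defs.nondegenerate p K.
Hypothesis normals : edge_normals p cells nF.
Hypothesis basis : CR_basis Omega p nF phi.
Implicit Types (K : {set 'I_nv}) (i : 'I_#|edges cells|).

Lemma measurable_supp i :
  measurable (supp p phi i : set (measurableTypeR R * measurableTypeR R)).
Proof. by apply: closed_measurable_plane; exact: closed_closure. Qed.

(** The function is 1 at the midpoint of its edge, hence positive at points of an
    adjacent open cell close to it, and then on a neighbourhood of one. *)
Lemma area_supp_gt0 i : (0 < area (supp p phi i))%E.
Proof.
have FE : edge_of i \in edges cells by exact: enum_valP.
have /exists_inP[K Kc FK] : [exists K in cells, edge_of i \subset K].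
  by move: (FE); rewrite inE => /andP[].
have FK' : edge_of i \in cell_edges cells K by rewrite inE FE.
have [[/(_ K Kc)[c [g phiE]] _] /(_ i K Kc FK)] := basis i.
set n := outward p nF K (edge_of i).
have F2 := card_cell_edge FK'.
have s01 : 0 < (2^-1 : R) < 1 by apply/andP; split; lra.
rewrite (midpoint_edge_pt p F2) eqxx (trace_affine triangles normals Kc FK' s01 phiE).
set x := edge_pt _ _ _ => x1; have {}x1 : c + dot g x = 1 by rewrite x1.
have near1 := near_right_affine_gt0 (- dot g n) (ltr01 : 0 < 1 :> R).
have := inward_ray triangles normals Kc FK' s01.
rewrite -/n -/x => /(filterI near1)/filter_ex[e [pos Ky]].
apply: (area_gt0 (measurable_supp i) (x := x - e *: n)).
have phi_pos : \forall y \near x - e *: n, 0 < c + dot g y.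
  have aff_cont : {for x - e *: n, continuous (fun y : R * R => c + dot g y)}.
    apply: cvgD; first exact: cvg_cst.
    by apply: cvgD; apply: cvgM; try exact: cvg_cst; [exact: cvg_fst|exact: cvg_snd].
  have pos' : 0 < c + dot g (x - e *: n) by move: pos; rewrite dotBr dotZr; lra.
  exact: (cvgr_gt _ aff_cont _ pos').
have near_cell : \forall y \near x - e *: n, ohull p K y.
  by have := open_ohull triangles Kc; rewrite openE; apply.
near=> y; apply: subset_closure; split.
  by exists K => //; near: y.
have Ky' : ohull p K y by near: y.
by rewrite phiE // gt_eqF //; near: y.
Unshelve. all: end_near. Qed.

(** The cells lie in a ball that bounds all weighted means of the vertices. *)
Lemma area_supp_lty i : (area (supp p phi i) < +oo)%E.
Proof.
apply: (area_bounded (M := \sum_d `|p d|) (measurable_supp i)).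
have cl : closed [set x : R * R | `|x| <= \sum_d `|p d|].
  apply: (@closed_comp _ _ (fun x : R * R => `|x|) [set t | t <= _]).
    by move=> x _; exact: norm_continuous.
  exact: closed_le.
rewrite ((closure_id _).1 cl); apply: closure_subset.
move=> x [[K Kc [w [w0 w1 ->]]] _] /=.
apply: le_trans (ler_norm_sum _ _ _) _.
rewrite [leRHS](bigID (mem K)) /=; apply: ler_wpDr; first exact: sumr_ge0.
apply: ler_sum => d dK; rewrite normrZ ler_piMl // gtr0_norm ?w0 //.
rewrite -w1 (bigD1 d) //= lerDl; apply: sumr_ge0 => a /andP[aK _].
by apply/ltW/w0.
Qed.

Lemma lumped_mass_gt0 i : 0 < lumped_mass p phi i.
Proof.
rewrite /lumped_mass divr_gt0 // fine_gt0 //.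
by rewrite area_supp_gt0 area_supp_lty.
Qed.

Lemma self_near_dof i : i \in near_dofs p phi (supp p phi i).
Proof. by rewrite inE setIid gt_eqF // area_supp_gt0. Qed.

End Masses.

(** * The scheme with minimum viscosity *)

Lemma invmx_diag (F : fieldType) N (d : 'rV[F]_N) :
  (forall i, d 0 i != 0) -> invmx (diag_mx d) = diag_mx (\row_i (d 0 i)^-1).
Proof.
move=> d0.
have e1 : diag_mx d *m diag_mx (\row_i (d 0 i)^-1) = 1%:M.
  by apply/matrixP => i j; rewrite mul_diag_mx !mxE mulrnAr mulfV.
by rewrite -[LHS]mulmx1 -e1 mulmxA mulVmx ?mul1mx //; case/mulmx1_unit: e1.
Qed.

Section ViscosityScheme.
Variables (R : realType) (N : nat) (S : 'M[R]_N).
Hypothesis row_sum0 : forall i, \sum_j S i j = 0.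

Let L := S - min_viscosity S.

Lemma min_viscosity_row_sum i : \sum_j min_viscosity S i j = 0.
Proof.
rewrite (bigD1 i) //= !mxE eqxx addrC; apply/eqP; rewrite subr_eq0; apply/eqP.
by apply: eq_bigr => j ji; rewrite !mxE eq_sym (negbTE ji).
Qed.

Lemma stabilized_row_sum i : \sum_j L i j = 0.
Proof.
rewrite (eq_bigr (fun j => S i j - min_viscosity S i j)) => [|j _].
  by rewrite sumrB row_sum0 min_viscosity_row_sum subrr.
by rewrite !mxE.
Qed.

Lemma stabilized_offdiag_le0 i j : j != i -> L i j <= 0.
Proof.
move=> ji; rewrite !mxE eq_sym (negbTE ji) subr_le0 !le_max lexx.
by rewrite orbT.
Qed.

(** The diagonal entry is minus the sum of the others in its row. *)
Lemma stabilized_diag_ge0 i : 0 <= L i i.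
Proof.
have := stabilized_row_sum i; rewrite (bigD1 i) //= => /eqP.
rewrite addr_eq0 => /eqP ->; rewrite oppr_ge0; apply: sumr_le0 => j ji.
exact: stabilized_offdiag_le0.
Qed.

Variables (m : 'I_N -> R) (dt : R).
Hypotheses (m_gt0 : forall i, 0 < m i) (dt_gt0 : 0 < dt).
Hypothesis cfl : forall i, L i i != 0 -> dt <= m i / L i i.

Let step (U : 'cV[R]_N) :=
  (1%:M - dt *: (invmx (diag_mx (\row_i m i)) *m L)) *m U.

Lemma stepE (U : 'cV[R]_N) i : step U i 0 = U i 0 - dt / m i * \sum_j L i j * U j 0.
Proof.
rewrite /step mulmxBl mul1mx -scalemxAl -mulmxA invmx_diag => [|k]; last first.
  by rewrite mxE gt_eqF.
by rewrite mul_diag_mx !mxE mulrA.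
Qed.

(** Zero row sums make the step commute with subtracting the constant [c]; what
    remains is a combination of the nonnegative [U_j - c] with nonnegative
    weights, the one of [U_i - c] by the bound on the time step. *)
Lemma step_ge (c : R) (U : 'cV[R]_N) : (forall i, c <= U i 0) -> forall i, c <= step U i 0.
Proof.
move=> cU i; rewrite stepE -subr_ge0.
have -> : \sum_j L i j * U j 0 = \sum_j L i j * (U j 0 - c).
  under [RHS]eq_bigr do rewrite mulrBr.
  by rewrite sumrB -mulr_suml stabilized_row_sum mul0r subr0.
rewrite (bigD1 i) //=; set rest := \sum_(j | j != i) _.
have -> : U i 0 - dt / m i * (L i i * (U i 0 - c) + rest) - c =
  (1 - dt / m i * L i i) * (U i 0 - c) + dt / m i * - rest by ring.
have q0 : 0 < dt / m i by rewrite divr_gt0.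
apply: addr_ge0; apply: mulr_ge0; rewrite ?subr_ge0 //.
- have [->|L0] := eqVneq (L i i) 0; first by rewrite mulr0 ler01.
  have Lgt0 : 0 < L i i by rewrite lt_def L0 stabilized_diag_ge0.
  by rewrite mulrAC ler_pdivrMr // mul1r -ler_pdivlMr // cfl.
- exact: ltW.
- rewrite oppr_ge0; apply: sumr_le0 => j ji; rewrite mulr_le0_ge0 //.
    exact: stabilized_offdiag_le0.
  by rewrite subr_ge0.
Qed.



Lemma step_le (c : R) (U : 'cV[R]_N) :
  (forall i, U i 0 <= c) -> forall i, step U i 0 <= c.
Proof.
move=> Uc i; rewrite -lerN2.
have -> : - step U i 0 = step (- U) i 0 by rewrite /step mulmxN [RHS]mxE.
by apply: step_ge => k; rewrite mxE lerN2.
Qed.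

(** The bounds are extended reals because the essential bounds of the data
    are. *)
Lemma step_between (umin umax : \bar R) (U : 'cV[R]_N) :
  (forall i, (umin <= (U i 0)%:E <= umax)%E) ->
  forall i, (umin <= (step U i 0)%:E <= umax)%E.
Proof.
move=> bnd i; apply/andP; split.
- case: umin bnd => [c||] bnd.
  + by rewrite lee_fin; apply: step_ge => k; have /andP[] := bnd k.
  + by have /andP[] := bnd i; rewrite leye_eq.
  + exact: leNye.
- case: umax bnd => [c||] bnd.
  + by rewrite lee_fin; apply: step_le => k; have /andP[] := bnd k.
  + exact: leey.
  + by have /andP[] := bnd i; rewrite leeNy_eq.
Qed.

End ViscosityScheme.

(** The middle inequality compares the minimum and the maximum through the
    value at [i], which is why [i] has to be one of its own neighbours. *)
Lemma local_DMP_of_bounds (R : realType) (nv : nat) (p : 'I_nv -> R * R)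
    (cells : {set {set 'I_nv}}) (phi : 'I_#|edges cells| -> R * R -> R)
    (umin umax : \bar R) (U : nat -> 'cV[R]_#|edges cells|) :
  (forall i, i \in near_dofs p phi (supp p phi i)) ->
  (forall n i, (umin <= (U n i 0)%:E <= umax)%E) ->
  local_DMP p phi umin umax U.
Proof.
move=> self bnd n i lo hi; split.
- rewrite /lo; elim/big_ind: _ => [|y z ? ?|j _]; first exact: leey.
    by rewrite le_min; apply/andP.
  by have /andP[] := bnd n j.
- apply: (@le_trans _ _ (U n i 0)%:E).
    by rewrite /lo (bigD1 i) ?self //= ge_min lexx.
  by rewrite /hi (bigD1 i) ?self //= le_max lexx.
- rewrite /hi; elim/big_ind: _ => [|y z ? ?|j _]; first exact: leNye.
    by rewrite ge_max; apply/andP.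
  by have /andP[] := bnd n j.
Qed.

Theorem theorem4p3 (R : realType) (Omega : set (R * R)) (nv : nat)
    (p : 'I_nv -> R * R) (cells : {set {set 'I_nv}})
    (nF : {set 'I_nv} -> R * R)
    (phi : 'I_#|edges cells| -> R * R -> R)
    (beta : R -> R * R -> R * R) (u0 : R * R -> R)
    (hOmega : polygonal_domain Omega)
    (hmesh : triangulation Omega p cells)
    (hnF : edge_normals p cells nF)
    (hphi : CR_basis Omega p nF phi)
    (hbeta : velocity_field Omega p cells nF beta)
    (hbounded : velocity_bounded Omega beta)
    (hinflow : no_inflow Omega p cells nF beta)
    (hu0 : bounded_data Omega u0) :
  let leb2 := (@lebesgue_measure R \x @lebesgue_measure R)%E in
  let umin := ess_inf_on leb2 Omega u0 in
  let umax := ess_sup_on leb2 Omega u0 in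
  let m := lumped_mass p phi in
  let M := mass_matrix p phi in
  let S := fun t => transport_matrix Omega p nF (beta t) phi in
  let V := fun t => min_viscosity (S t) in
  (* the time steps are sufficiently small *)
  (exists delta : R -> R, (forall t, 0 <= t -> 0 < delta t) /\
     forall (t : nat -> R) (U : nat -> 'cV[R]_#|edges cells|),
       time_levels t ->
       (forall i, (umin <= (U 0%N i 0)%:E <= umax)%E) ->
       scheme M S V t U ->
       (forall n, time_step t n <= delta (t n)) ->
       local_DMP p phi umin umax U) /\
  (* the precise sufficient condition *)
  (forall (t : nat -> R) (U : nat -> 'cV[R]_#|edges cells|),
     time_levels t ->
     (forall i, (umin <= (U 0%N i 0)%:E <= umax)%E) ->
     scheme M S V t U ->
     (forall n i, S (t n) i i - V (t n) i i != 0 ->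
        time_step t n <= m i / (S (t n) i i - V (t n) i i)) ->
     local_DMP p phi umin umax U).
Proof.
move=> leb2 umin umax m M S V.
have triangles K : K \in cells -> #|K| = 3%N /\ Defs.nondegenerate p K.
  by case: hmesh => h _ _; exact: h.
have m0 i : 0 < m i by exact: lumped_mass_gt0 triangles hnF hphi i.
have rows t : 0 <= t -> forall i, \sum_j S t i j = 0.
  move=> t0 i; have [h1 [h2 h3]] := hbeta t t0.
  have [phi_i _] := hphi i.
  under eq_bigr do rewrite mxE.
  rewrite sumrB (a_form_sum0 hmesh hnF hphi h1 phi_i).
  rewrite (b_form_sum0 hmesh hnF hphi _ h3 phi_i) ?subrr // => K F Kc FK.
  by have [] := h2 K F Kc FK.
have dmp (t : nat -> R) (U : nat -> 'cV[R]_#|edges cells|) : time_levels t ->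
     (forall i, (umin <= (U 0%N i 0)%:E <= umax)%E) ->
     scheme M S V t U ->
     (forall n i, S (t n) i i - V (t n) i i != 0 ->
        time_step t n <= m i / (S (t n) i i - V (t n) i i)) ->
     local_DMP p phi umin umax U.
  move=> [t0 tlt] U0 sch cfl; apply: local_DMP_of_bounds.
    exact: self_near_dof triangles hnF hphi.
  have tn n : 0 <= t n by elim: n => // n IH; exact: le_trans IH (ltW (tlt n)).
  have cfl' n i : (S (t n) - V (t n)) i i != 0 ->
      time_step t n <= m i / (S (t n) - V (t n)) i i.
    by rewrite !mxE; have := cfl n i; rewrite !mxE.
  have dt0 n : 0 < time_step t n by rewrite subr_gt0.
  elim=> // n IH; rewrite sch.
  exact: (step_between (rows _ (tn n)) m0 (dt0 n) (cfl' n) IH).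
split=> //.
(* the sharp bound is positive, since [L t i] is nonnegative; indices with
   [L t i = 0] are left out and 1 is an arbitrary cap *)
pose L t i := S t i i - V t i i.
pose delta t := \big[Num.min/1]_(i | L t i != 0) (m i / L t i).
exists delta; split=> [t t0|t U lev U0 sch dtd].
  rewrite /delta; elim/big_ind: _ => [|y z ? ?|i Li]; first exact: ltr01.
    by rewrite lt_min; apply/andP.
  rewrite divr_gt0 // lt_def Li; have := stabilized_diag_ge0 (rows t t0) i.
  by rewrite /L /V !mxE.
apply: (dmp t U lev U0 sch) => n i Li; apply: (le_trans (dtd n)).
by rewrite /delta (bigD1 i) //= ge_min lexx.
Qed.
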